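(* Let $(\mathcal C,\alpha)$ be a grading category, $A$ a $\mathcal C$-graded algebra, and $M$ an invertible object of $\mathcal K^{\mathcal C}(A)$. Then $$\mathrm{Hom}_{\mathcal K^{\mathcal C}(A)}(M,M)\cong\mathrm{Hom}_{\mathrm{Bim}(A,A)^{\mathcal C}}(A,A)$$ as $\Bbbk$-modules. Consequently, the group of automorphisms of $M$ in $\mathcal K^{\mathcal C}(A)$ is isomorphic to $Z^{\mathcal C}_*(A)$.
   Context: Let $\Bbbk$ be a commutative unital ring with unit group $\Bbbk^\times$ and $\mathcal C$ a small category. A grading category $(\mathcal C,\alpha)$: $\alpha$ assigns to each composable triple $(f_1,f_2,f_3)$ (so $f_3\circ f_2\circ f_1$ is defined) an element of $\Bbbk^\times$ such that for all composable $(f_1,f_2,f_3,f_4)$: $\alpha(f_1,f_2,f_3)\,\alpha(f_1,f_2,f_4\circ f_3)^{-1}\alpha(f_1,f_3\circ f_2,f_4)\,\alpha(f_2\circ f_1,f_3,f_4)^{-1}\alpha(f_2,f_3,f_4)=1$. A $\mathcal C$-graded module is a $\Bbbk$-module $M=\bigoplus_{g\in\mathrm{Mor}(\mathcal C)}M_g$; write $|x|=g$ for $x\in M_g$. Graded maps are $\Bbbk$-linear and preserve each $M_g$. $(M\otimes N)_g=\bigoplus_{g=g_2\circ g_1}M_{g_1}\otimes_\Bbbk N_{g_2}$ (products of elements with non-composable degrees are zero). Typical unitor constants (used throughout): for $g:X\to Y$, $\mathcal L(\mathrm{Id}_X,g)=\alpha(\mathrm{Id}_X,\mathrm{Id}_X,g)^{-1}$,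 $\mathcal R(g,\mathrm{Id}_Y)=\alpha(g,\mathrm{Id}_Y,\mathrm{Id}_Y)$. A $\mathcal C$-graded algebra is a $\mathcal C$-graded module $A$ with a graded $\Bbbk$-linear $\mu:A\otimes A\to A$ and elements $1_X\in A_{\mathrm{Id}_X}$ with, for homogeneous elements, $\mu(\mu(x,y),z)=\alpha(|x|,|y|,|z|)\mu(x,\mu(y,z))$, $\mu(1_X,x)=\mathcal L(\mathrm{Id}_X,|x|)x$, $\mu(x,1_Y)=\mathcal R(|x|,\mathrm{Id}_Y)x$ if $|x|:X\to Y$. A $\mathcal C$-graded $(A,A)$-bimodule is a $\mathcal C$-graded module $M$ with graded maps $\rho_L:A\otimes M\to M$, $\rho_R:M\otimes A\to M$ such that $\rho_L(\mu(a,a'),m)=\alpha(|a|,|a'|,|m|)\rho_L(a,\rho_L(a',m))$, $\rho_R(\rho_R(m,b),b')=\alpha(|m|,|b|,|b'|)\rho_R(m,\mu(b,b'))$, $\rho_R(\rho_L(a,m),b)=\alpha(|a|,|m|,|b|)\rho_L(a,\rho_R(m,b))$, $\rho_L(1_X,m)=\mathcal L(\mathrm{Id}_X,|m|)m$, $\rho_R(m,1_Y)=\mathcal R(|m|,\mathrm{Id}_Y)m$ for $|m|:X\to Y$. $\mathrm{Bim}(A,A)^{\mathcal C}$ is the category of these with graded maps commuting with the actions; $A$ is a bimodule over itself via $\mu$. $M\otimes_AN$ is $M\otimes N$ modulo $\rho_R(m,a)\otimes n=\alpha(|m|,|a|,|n|)\,m\otimes\rho_L(a,n)$, with $\rho_L(a,m\otimes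 n)=\alpha(|a|,|m|,|n|)^{-1}\rho_L(a,m)\otimes n$ and $\rho_R(m\otimes n,a)=\alpha(|m|,|n|,|a|)\,m\otimes\rho_R(n,a)$; for complexes one takes the usual total tensor product. $\mathcal K^{\mathcal C}(A)$: objects are bounded complexes of $\mathcal C$-graded $(A,A)$-bimodules with grading-preserving differential (a bimodule map); morphisms are grading-preserving chain maps of bimodules up to chain homotopy. $M\in\mathcal K^{\mathcal C}(A)$ is invertible if there is $N\in\mathcal K^{\mathcal C}(A)$ with $N\otimes_AM\simeq A$ and $M\otimes_AN\simeq A$, $A$ being the complex $0\to A\to0$ concentrated in degree $0$. The center: $Z^{\mathcal C}(A)$ is the set of formal sums $z=\sum_Xz_X$, $z_X\in A_{\mathrm{Id}_X}$ ($X\in\mathrm{Ob}(\mathcal C)$), with $\mu(a,z)=\zeta(|a|)\mu(z,a)$ for all homogeneous $a$, where $\zeta(g)=\alpha(\mathrm{Id}_X,\mathrm{Id}_X,g)\alpha(g,\mathrm{Id}_Y,\mathrm{Id}_Y)$ for $g:X\to Y$. $Z_*^{\mathcal C}(A)=\{z\in Z^{\mathcal C}(A):\exists z'\in Z^{\mathcal C}(A),\ \mu(z,z')=1\}$ with $1=\sum_X1_X$; it is a group under $\mu$. *)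

(* Defs.v *)
From HB Require Import structures.
From mathcomp Require Import all_boot all_order all_algebra boolp ring.

Set Implicit Arguments.
Unset Strict Implicit.
Unset Printing Implicit Defensive.
Import Order.TTheory GRing.Theory Num.Theory.
Local Open Scope ring_scope.
Local Open Scope quotient_scope.

Record category := Category {
  ob :> Type;
  hom : ob -> ob -> Type;
  idm : forall X, hom X X;
  comp : forall X Y Z, hom Y Z -> hom X Y -> hom X Z;
  comp_idl : forall X Y (f : hom X Y), comp (idm Y) f = f;
  comp_idr : forall X Y (f : hom X Y), comp f (idm X) = f;
  compA : forall X Y Z W (f : hom X Y) (g : hom Y Z) (h : hom Z W),
    comp h (comp g f) = comp (comp h g) f }.

Notation "g ∘ f" := (comp g f) (at level 40, left associativity).

Record mor (C : category) := Mor {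
  src : C;
  tgt : C;
  arr : hom src tgt }.
Coercion Mor : hom >-> mor.

(* The library's unit rings are nontrivial; the unit group is spelled out so
   that the zero ring is allowed. *)
Record kunit (k : comPzRingType) := KUnit {
  uval :> k;
  uinv : k;
  uvalV : uval * uinv = 1 }.

Record gradingCategory (k : comPzRingType) := GradingCategory {
  gcat :> category;
  alpha : forall (X Y Z W : gcat), hom X Y -> hom Y Z -> hom Z W -> kunit k;
  alpha_cocycle : forall (X Y Z W V : gcat) (f1 : hom X Y) (f2 : hom Y Z)
      (f3 : hom Z W) (f4 : hom W V),
    uval (alpha f1 f2 f3) * uinv (alpha f1 f2 (f4 ∘ f3))
    * uval (alpha f1 (f3 ∘ f2) f4) * uinv (alpha (f2 ∘ f1) f3 f4)
    * uval (alpha f2 f3 f4) = 1 }.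

Definition is_bilinear (k : comPzRingType) (U V W : lmodType k)
    (b : U -> V -> W) :=
  (forall y, linear (b^~ y)) /\ (forall x, linear (b x)).

(* A graded module is a family mor C -> lmodType k of homogeneous components.
   A graded map out of a tensor product of graded modules is a family of
   bilinear maps A_f x A_g -> A_h indexed by the factorizations h = g ∘ f.
   Carrying the equation as an argument, instead of taking values in
   A_(g ∘ f), avoids transports along the category laws; by proof irrelevance the choice of
   the proof is immaterial. *)
Record galgebra (k : comPzRingType) (C : gradingCategory k) := GAlgebra {
  acar :> mor C -> lmodType k;
  mu : forall (X Y Z : C) (f : hom X Y) (g : hom Y Z) (h : hom X Z),
    h = g ∘ f -> acar f -> acar g -> acar h;
  one : forall X : C, acar (idm X);
  mu_bilinear : forall (X Y Z : C) (f : hom X Y) (g : hom Y Z) (h : hom X Z)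
    (e : h = g ∘ f), is_bilinear (mu e);
  mu_assoc : forall (X Y Z W : C) (f : hom X Y) (g : hom Y Z) (h : hom Z W)
      (gf : hom X Z) (hg : hom Y W) (l : hom X W)
      (e1 : gf = g ∘ f) (e2 : l = h ∘ gf) (e3 : hg = h ∘ g) (e4 : l = hg ∘ f)
      (x : acar f) (y : acar g) (z : acar h),
    mu e2 (mu e1 x y) z = uval (alpha f g h) *: mu e4 x (mu e3 y z);
  mu_1l : forall (X Y : C) (f : hom X Y) (e : f = f ∘ idm X) (x : acar f),
    mu e (one X) x = uinv (alpha (idm X) (idm X) f) *: x;
  mu_1r : forall (X Y : C) (f : hom X Y) (e : f = idm Y ∘ f) (x : acar f),
    mu e x (one Y) = uval (alpha f (idm Y) (idm Y)) *: x }.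

Record bimod (k : comPzRingType) (C : gradingCategory k) (A : galgebra C) :=
    Bimod {
  bcar :> mor C -> lmodType k;
  lact : forall (X Y Z : C) (f : hom X Y) (g : hom Y Z) (h : hom X Z),
    h = g ∘ f -> A f -> bcar g -> bcar h;
  ract : forall (X Y Z : C) (f : hom X Y) (g : hom Y Z) (h : hom X Z),
    h = g ∘ f -> bcar f -> A g -> bcar h;
  lact_bilinear : forall (X Y Z : C) (f : hom X Y) (g : hom Y Z) (h : hom X Z)
    (e : h = g ∘ f), is_bilinear (lact e);
  ract_bilinear : forall (X Y Z : C) (f : hom X Y) (g : hom Y Z) (h : hom X Z)
    (e : h = g ∘ f), is_bilinear (ract e);
  lact_assoc : forall (X Y Z W : C) (f : hom X Y) (g : hom Y Z) (h : hom Z W)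
      (gf : hom X Z) (hg : hom Y W) (l : hom X W)
      (e1 : gf = g ∘ f) (e2 : l = h ∘ gf) (e3 : hg = h ∘ g) (e4 : l = hg ∘ f)
      (a : A f) (a' : A g) (m : bcar h),
    lact e2 (mu e1 a a') m = uval (alpha f g h) *: lact e4 a (lact e3 a' m);
  ract_assoc : forall (X Y Z W : C) (f : hom X Y) (g : hom Y Z) (h : hom Z W)
      (gf : hom X Z) (hg : hom Y W) (l : hom X W)
      (e1 : gf = g ∘ f) (e2 : l = h ∘ gf) (e3 : hg = h ∘ g) (e4 : l = hg ∘ f)
      (m : bcar f) (b : A g) (b' : A h),
    ract e2 (ract e1 m b) b' = uval (alpha f g h) *: ract e4 m (mu e3 b b');
  lract_assoc : forall (X Y Z W : C) (f : hom X Y) (g : hom Y Z) (h : hom Z W)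
      (gf : hom X Z) (hg : hom Y W) (l : hom X W)
      (e1 : gf = g ∘ f) (e2 : l = h ∘ gf) (e3 : hg = h ∘ g) (e4 : l = hg ∘ f)
      (a : A f) (m : bcar g) (b : A h),
    ract e2 (lact e1 a m) b = uval (alpha f g h) *: lact e4 a (ract e3 m b);
  lact_1 : forall (X Y : C) (f : hom X Y) (e : f = f ∘ idm X) (m : bcar f),
    lact e (one A X) m = uinv (alpha (idm X) (idm X) f) *: m;
  ract_1 : forall (X Y : C) (f : hom X Y) (e : f = idm Y ∘ f) (m : bcar f),
    ract e m (one A Y) = uval (alpha f (idm Y) (idm Y)) *: m }.

Definition regular (k : comPzRingType) (C : gradingCategory k)
    (A : galgebra C) : bimod A :=
  Bimod (@mu_bilinear k C A) (@mu_bilinear k C A)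
    (@mu_assoc k C A) (@mu_assoc k C A) (@mu_assoc k C A)
    (@mu_1l k C A) (@mu_1r k C A).

Section BimHom.
Variables (k : comPzRingType) (C : gradingCategory k) (A : galgebra C).

Record bimhom (M N : bimod A) := BimHom {
  bfun : forall f : mor C, M f -> N f;
  bfun_linear : forall f, linear (@bfun f);
  bfun_lact : forall (X Y Z : C) (f : hom X Y) (g : hom Y Z) (h : hom X Z)
      (e : h = g ∘ f) (a : A f) (m : M g),
    bfun (lact e a m) = lact e a (bfun m);
  bfun_ract : forall (X Y Z : C) (f : hom X Y) (g : hom Y Z) (h : hom X Z)
      (e : h = g ∘ f) (m : M f) (a : A g),
    bfun (ract e m a) = ract e (bfun m) a }.

Lemma bimhom_eq (M N : bimod A) (u v : bimhom M N) :
  (forall f (x : M f), bfun u x = bfun v x) -> u = v.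
Proof.
case: u v => [u ul uL uR] [v vl vL vR] /= uv.
have E : u = v.
  by apply: functional_extensionality_dep => f; apply/funext => x; exact: uv.
case: v / E {uv} vl vL vR => vl vL vR.
by congr BimHom; apply: Prop_irrelevance.
Qed.

HB.instance Definition _ (M N : bimod A) (u : bimhom M N) (f : mor C) :=
  GRing.isLinear.Build k (M f) (N f) *:%R (@bfun M N u f) (@bfun_linear M N u f).

HB.instance Definition _ (M N : bimod A) := gen_eqMixin (bimhom M N).
HB.instance Definition _ (M N : bimod A) := gen_choiceMixin (bimhom M N).

Section Lact.
Variables (M : bimod A) (X Y Z : C) (f : hom X Y) (g : hom Y Z) (h : hom X Z).
Variable e : h = g ∘ f.

Definition lactr_of (a : A f) : M g -> M h := lact e a.
Definition lactl_of (m : M g) : A f -> M h := (lact e)^~ m.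
Definition ractr_of (m : M f) : A g -> M h := ract e m.
Definition ractl_of (a : A g) : M f -> M h := (ract e)^~ a.

HB.instance Definition _ a := GRing.isLinear.Build k (M g) (M h) *:%R
  (lactr_of a) ((lact_bilinear M e).2 a).
HB.instance Definition _ m := GRing.isLinear.Build k (A f) (M h) *:%R
  (lactl_of m) ((lact_bilinear M e).1 m).
HB.instance Definition _ m := GRing.isLinear.Build k (A g) (M h) *:%R
  (ractr_of m) ((ract_bilinear M e).2 m).
HB.instance Definition _ a := GRing.isLinear.Build k (M f) (M h) *:%R
  (ractl_of a) ((ract_bilinear M e).1 a).

Lemma lact0r (a : A f) : lact e a (0 : M g) = 0.
Proof. exact: (raddf0 (lactr_of a)). Qed.
Lemma lactDr (a : A f) (m n : M g) : lact e a (m + n) = lact e a m + lact e a n.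
Proof. exact: (raddfD (lactr_of a)). Qed.
Lemma lactZr c (a : A f) (m : M g) : lact e a (c *: m) = c *: lact e a m.
Proof. exact: (linearZ_LR (lactr_of a)). Qed.
Lemma lactDl (a b : A f) (m : M g) : lact e (a + b) m = lact e a m + lact e b m.
Proof. exact: (raddfD (lactl_of m)). Qed.
Lemma lactZl c (a : A f) (m : M g) : lact e (c *: a) m = c *: lact e a m.
Proof. exact: (linearZ_LR (lactl_of m)). Qed.
Lemma ract0l (a : A g) : ract e (0 : M f) a = 0.
Proof. exact: (raddf0 (ractl_of a)). Qed.
Lemma ractDl (a : A g) (m n : M f) : ract e (m + n) a = ract e m a + ract e n a.
Proof. exact: (raddfD (ractl_of a)). Qed.
Lemma ractZl c (a : A g) (m : M f) : ract e (c *: m) a = c *: ract e m a.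
Proof. exact: (linearZ_LR (ractl_of a)). Qed.
Lemma ractDr (a b : A g) (m : M f) : ract e m (a + b) = ract e m a + ract e m b.
Proof. exact: (raddfD (ractr_of m)). Qed.
Lemma ractZr c (a : A g) (m : M f) : ract e m (c *: a) = c *: ract e m a.
Proof. exact: (linearZ_LR (ractr_of m)). Qed.
End Lact.

Section BimHomLmod.
Variables M N : bimod A.
Implicit Types (c d : k) (u v w : bimhom M N).

Definition bimhom0 : bimhom M N.
Proof.
exists (fun f _ => 0) => [f c x y|X Y Z f g h e a m|X Y Z f g h e m a].
- by rewrite scaler0 addr0.
- by rewrite lact0r.
- by rewrite ract0l.
Defined.

Definition bimhomD u v : bimhom M N.
Proof.
exists (fun f x => bfun u x + bfun v x) => [f c x y|X Y Z f g h e a m|X Y Z f g h e m a].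
- by rewrite !linearP scalerDr addrACA.
- by rewrite !bfun_lact lactDr.
- by rewrite !bfun_ract ractDl.
Defined.

Definition bimhomZ c u : bimhom M N.
Proof.
exists (fun f x => c *: bfun u x) => [f d x y|*|*].
- by rewrite linearP scalerDr !scalerA mulrC.
- by rewrite bfun_lact lactZr.
- by rewrite bfun_ract ractZl.
Defined.

Definition bimhomN u : bimhom M N := bimhomZ (-1) u.

Fact bimhom_addA : associative bimhomD.
Proof. by move=> u v w; apply: bimhom_eq => f x /=; rewrite addrA. Qed.
Fact bimhom_addC : commutative bimhomD.
Proof. by move=> u v; apply: bimhom_eq => f x /=; rewrite addrC. Qed.
Fact bimhom_add0 : left_id bimhom0 bimhomD.
Proof. by move=> u; apply: bimhom_eq => f x /=; rewrite add0r. Qed.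
Fact bimhom_addN : left_inverse bimhom0 bimhomN bimhomD.
Proof. by move=> u; apply: bimhom_eq => f x /=; rewrite scaleN1r addNr. Qed.
HB.instance Definition _ := GRing.isZmodule.Build (bimhom M N)
  bimhom_addA bimhom_addC bimhom_add0 bimhom_addN.

Fact bimhom_scaleA c d u : bimhomZ c (bimhomZ d u) = bimhomZ (c * d) u.
Proof. by apply: bimhom_eq => f x /=; rewrite scalerA. Qed.
Fact bimhom_scale1 : left_id 1 bimhomZ.
Proof. by move=> u; apply: bimhom_eq => f x /=; rewrite scale1r. Qed.
Fact bimhom_scaleDr : right_distributive bimhomZ +%R.
Proof. by move=> c u v; apply: bimhom_eq => f x /=; rewrite scalerDr. Qed.
Fact bimhom_scaleDl u : {morph bimhomZ^~ u : c d / c + d}.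
Proof. by move=> c d; apply: bimhom_eq => f x /=; rewrite scalerDl. Qed.
HB.instance Definition _ := GRing.Zmodule_isLmodule.Build k (bimhom M N)
  bimhom_scaleA bimhom_scale1 bimhom_scaleDr bimhom_scaleDl.

Lemma bfunD u v f (x : M f) : bfun (u + v) x = bfun u x + bfun v x.
Proof. by []. Qed.
Lemma bfunZ c u f (x : M f) : bfun (c *: u) x = c *: bfun u x.
Proof. by []. Qed.
Lemma bfun0 f (x : M f) : bfun (0 : bimhom M N) x = 0.
Proof. by []. Qed.
Lemma bfunN u f (x : M f) : bfun (- u) x = - bfun u x.
Proof. by rewrite -scaleN1r. Qed.
End BimHomLmod.

Definition bimid (M : bimod A) : bimhom M M.
Proof. by exists (fun f x => x). Defined.

Definition bimcomp (M N P : bimod A) (v : bimhom N P) (u : bimhom M N) :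
  bimhom M P.
Proof.
exists (fun f x => bfun v (bfun u x)) => [f c x y|X Y Z f g h e a m|X Y Z f g h e m a].
- by rewrite !linearP.
- by rewrite !bfun_lact.
- by rewrite !bfun_ract.
Defined.

Fact zero_bilinear (U V W : lmodType k) :
  is_bilinear (fun (_ : U) (_ : V) => 0 : W).
Proof. by split=> ? ? ? ?; rewrite scaler0 addr0. Qed.

Definition zero_car (f : mor C) : lmodType k := 'rV[k]_0.

Fact zero_car_eq (f : mor C) (x y : zero_car f) : x = y.
Proof. exact: etrans (thinmx0 x) (esym (thinmx0 y)). Qed.

Definition zero_bimod : bimod A.
Proof.
exists zero_car (fun _ _ _ _ _ _ _ _ _ => 0) (fun _ _ _ _ _ _ _ _ _ => 0);
  do ?[by move=> *; exact: zero_bilinear | by move=> *; exact: zero_car_eq].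
Defined.

Lemma zero_bimod_eq (f : mor C) (x y : zero_bimod f) : x = y.
Proof. exact: zero_car_eq. Qed.
End BimHom.

Section Tensor.
Variables (k : comPzRingType) (C : gradingCategory k) (A : galgebra C).
Variables M N : bimod A.

(* A generator tx ⊗ ty of (M ⊗ N)_h; pairs of non-composable degrees do not
   occur. *)
Record tgen (h : mor C) := TGen {
  tmid : C;
  tf : hom (src h) tmid;
  tg : hom tmid (tgt h);
  te : arr h = tg ∘ tf;
  tx : M tf;
  ty : N tg }.

(* Equality of formal sums of generators in (M ⊗_A N)_h, the quotient of the
   direct sum of the M_f ⊗ N_g, h = g ∘ f, by the A-balancing relation. *)
Inductive tens_eq (h : mor C) : seq (tgen h) -> seq (tgen h) -> Prop :=
| tens_refl s : tens_eq s s
| tens_sym s t : tens_eq s t -> tens_eq t s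
| tens_trans s t u : tens_eq s t -> tens_eq t u -> tens_eq s u
| tens_cat s s' t t' : tens_eq s s' -> tens_eq t t' ->
    tens_eq (s ++ t) (s' ++ t')
| tens_comm s t : tens_eq (s ++ t) (t ++ s)
| tens_0 Y (f : hom (src h) Y) (g : hom Y (tgt h)) (e : arr h = g ∘ f)
    (y : N g) : tens_eq [:: TGen e (0 : M f) y] [::]
| tens_Dl Y (f : hom (src h) Y) (g : hom Y (tgt h)) (e : arr h = g ∘ f)
    (x x' : M f) (y : N g) :
    tens_eq [:: TGen e (x + x') y] [:: TGen e x y; TGen e x' y]
| tens_Dr Y (f : hom (src h) Y) (g : hom Y (tgt h)) (e : arr h = g ∘ f)
    (x : M f) (y y' : N g) :
    tens_eq [:: TGen e x (y + y')] [:: TGen e x y; TGen e x y']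
| tens_Z Y (f : hom (src h) Y) (g : hom Y (tgt h)) (e : arr h = g ∘ f)
    (c : k) (x : M f) (y : N g) :
    tens_eq [:: TGen e (c *: x) y] [:: TGen e x (c *: y)]
| tens_bal Y Z (f : hom (src h) Y) (g : hom Y Z) (l : hom Z (tgt h))
    (gf : hom (src h) Z) (lg : hom Y (tgt h))
    (e1 : gf = g ∘ f) (e2 : arr h = l ∘ gf)
    (e3 : lg = l ∘ g) (e4 : arr h = lg ∘ f) (m : M f) (a : A g) (n : N l) :
    tens_eq [:: TGen e2 (ract e1 m a) n]
            [:: TGen e4 (uval (alpha f g l) *: m) (lact e3 a n)].

HB.instance Definition _ h := gen_eqMixin (tgen h).
HB.instance Definition _ h := gen_choiceMixin (tgen h).

Definition tens_rel h : rel (seq (tgen h)) := fun s t => `[< tens_eq s t >].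

Fact tens_rel_equiv h : equiv_class_of (@tens_rel h).
Proof.
split=> [s|s t|t s u]; first by apply/asboolP; exact: tens_refl.
  by apply/asboolP/asboolP; exact: tens_sym.
by move=> /asboolP st /asboolP tu; apply/asboolP; exact: tens_trans st tu.
Qed.
Canonical tens_rel_equivRel h := EquivRelPack (@tens_rel_equiv h).
Canonical tens_rel_encModRel h := defaultEncModRel (@tens_rel h).

Definition tens h := {eq_quot @tens_rel h}.
HB.instance Definition _ h := Choice.on (tens h).
HB.instance Definition _ h := EqQuotient.on (tens h).

Lemma tens_piP h (s t : seq (tgen h)) :
  reflect (tens_eq s t) (\pi_(tens h) s == \pi_(tens h) t).
Proof. by rewrite piE; exact: asboolP. Qed.

Section TensZmod.
Variable h : mor C.
Implicit Types s t : seq (tgen h).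

Definition tgenN (g : tgen h) : tgen h := TGen (te g) (- tx g) (ty g).

Fact tens_catN s : tens_eq (map tgenN s ++ s) [::].
Proof.
elim: s => [|[Y f g e x y] s IH] /=; first exact: tens_refl.
rewrite -cat1s -[TGen e x y :: s]cat1s.
apply: (@tens_trans _ _ ([:: TGen e (- x) y] ++ [:: TGen e x y])).
  apply: tens_cat; first exact: tens_refl.
  apply: tens_trans (tens_cat (tens_refl _) (tens_comm _ _)) _.
  rewrite catA -[X in tens_eq _ X]cat0s.
  exact: tens_cat IH (tens_refl _).
apply: tens_trans (tens_sym (tens_Dl _ _ _ _)) _.
by rewrite addNr; exact: tens_0.
Qed.

Fact tens_mapN s t : tens_eq s t -> tens_eq (map tgenN s) (map tgenN t).
Proof.
move=> st; rewrite -[map _ s]cats0.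
apply: (@tens_trans _ _ (map tgenN s ++ (t ++ map tgenN t))).
  apply: tens_cat; first exact: tens_refl.
  by apply: tens_trans (tens_comm _ _); apply/tens_sym/tens_catN.
rewrite catA -[X in tens_eq _ X]cat0s; apply: tens_cat (tens_refl _).
apply: tens_trans (tens_catN s).
exact: tens_cat (tens_refl _) (tens_sym st).
Qed.

Definition tensD (u v : tens h) : tens h :=
  \pi_(tens h) (repr u ++ repr v).
Definition tensN (u : tens h) : tens h := \pi_(tens h) (map tgenN (repr u)).
Definition tens0 : tens h := \pi_(tens h) [::].

Fact tensD_pi s t :
  tensD (\pi_(tens h) s) (\pi_(tens h) t) = \pi_(tens h) (s ++ t).
Proof.
by apply/eqP/tens_piP; apply: tens_cat; apply/tens_piP; rewrite reprK.
Qed.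

Fact tensN_pi s : tensN (\pi_(tens h) s) = \pi_(tens h) (map tgenN s).
Proof. by apply/eqP/tens_piP/tens_mapN/tens_piP; rewrite reprK. Qed.

Fact tens_addA : associative tensD.
Proof.
elim/quotW=> s; elim/quotW=> t; elim/quotW=> u.
by rewrite (tensD_pi s t) (tensD_pi t u) !tensD_pi catA.
Qed.
Fact tens_addC : commutative tensD.
Proof.
elim/quotW=> s; elim/quotW=> t; rewrite !tensD_pi.
exact/eqP/tens_piP/tens_comm.
Qed.
Fact tens_add0 : left_id tens0 tensD.
Proof. by elim/quotW=> s; rewrite tensD_pi. Qed.
Fact tens_addN : left_inverse tens0 tensN tensD.
Proof.
elim/quotW=> s; rewrite tensN_pi tensD_pi.
exact/eqP/tens_piP/tens_catN.
Qed.
HB.instance Definition _ := GRing.isZmodule.Build (tens h)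
  tens_addA tens_addC tens_add0 tens_addN.

Definition tpure Y (f : hom (src h) Y) (g : hom Y (tgt h)) (e : arr h = g ∘ f)
  (x : M f) (y : N g) : tens h := \pi_(tens h) [:: TGen e x y].
End TensZmod.
Arguments tpure {h Y f g} e x y.

Lemma tens_indp h (P : tens h -> Prop) :
  P 0 -> (forall u v, P u -> P v -> P (u + v)) ->
  (forall Y (f : hom (src h) Y) g (e : arr h = g ∘ f) x y, P (tpure e x y)) ->
  forall u, P u.
Proof.
move=> P0 PD Pp u; rewrite -[u]reprK.
elim: (repr u) => [|[Y f g e x y] s IH]; first exact: P0.
by rewrite -cat1s -tensD_pi; apply: PD => //; exact: Pp.
Qed.

Section Pure.
Variables (h : mor C) (Y : C) (f : hom (src h) Y) (g : hom Y (tgt h)).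
Variable e : arr h = g ∘ f.

Lemma tpureDl (x x' : M f) (y : N g) :
  tpure e (x + x') y = tpure e x y + tpure e x' y.
Proof. by rewrite [RHS]tensD_pi; exact/eqP/tens_piP/tens_Dl. Qed.
Lemma tpureDr (x : M f) (y y' : N g) :
  tpure e x (y + y') = tpure e x y + tpure e x y'.
Proof. by rewrite [RHS]tensD_pi; exact/eqP/tens_piP/tens_Dr. Qed.
Lemma tpureZlr c (x : M f) (y : N g) : tpure e (c *: x) y = tpure e x (c *: y).
Proof. exact/eqP/tens_piP/tens_Z. Qed.
Lemma tpure0l (y : N g) : tpure e (0 : M f) y = 0.
Proof. exact/eqP/tens_piP/tens_0. Qed.
Lemma tpure0r (x : M f) : tpure e x (0 : N g) = 0.
Proof. by rewrite -(scale0r (0 : N g)) -tpureZlr scale0r tpure0l. Qed.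
End Pure.

Lemma tpure_bal (h : mor C) Y Z (f : hom (src h) Y) (g : hom Y Z)
    (l : hom Z (tgt h)) (gf : hom (src h) Z) (lg : hom Y (tgt h))
    (e1 : gf = g ∘ f) (e2 : arr h = l ∘ gf)
    (e3 : lg = l ∘ g) (e4 : arr h = lg ∘ f) (m : M f) (a : A g) (n : N l) :
  tpure e2 (ract e1 m a) n
  = tpure e4 (uval (alpha f g l) *: m) (lact e3 a n).
Proof. exact/eqP/tens_piP/tens_bal. Qed.

Section Lift.
Variables (h : mor C) (V : zmodType).
Variable b : forall Y (f : hom (src h) Y) (g : hom Y (tgt h)),
  arr h = g ∘ f -> M f -> N g -> V.

Record balanced : Prop := Balanced {
  balancedDl : forall Y (f : hom (src h) Y) (g : hom Y (tgt h))
    (e : arr h = g ∘ f) x x' y, b e (x + x') y = b e x y + b e x' y;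
  balancedDr : forall Y (f : hom (src h) Y) (g : hom Y (tgt h))
    (e : arr h = g ∘ f) x y y', b e x (y + y') = b e x y + b e x y';
  balancedZ : forall Y (f : hom (src h) Y) (g : hom Y (tgt h))
    (e : arr h = g ∘ f) c x y, b e (c *: x) y = b e x (c *: y);
  balancedA : forall Y Z (f : hom (src h) Y) (g : hom Y Z)
    (l : hom Z (tgt h)) (gf : hom (src h) Z) (lg : hom Y (tgt h))
    (e1 : gf = g ∘ f) (e2 : arr h = l ∘ gf)
    (e3 : lg = l ∘ g) (e4 : arr h = lg ∘ f) (m : M f) (a : A g) (n : N l),
    b e2 (ract e1 m a) n = b e4 (uval (alpha f g l) *: m) (lact e3 a n) }.

Definition tens_lift (u : tens h) : V :=
  \sum_(g <- repr u) b (te g) (tx g) (ty g).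

Hypothesis b_bal : balanced.

Fact tens_lift_eq s t : tens_eq s t ->
  \sum_(g <- s) b (te g) (tx g) (ty g) = \sum_(g <- t) b (te g) (tx g) (ty g).
Proof.
elim=> {s t} /=.
- by [].
- by [].
- by move=> s t u _ -> _ ->.
- by move=> s s' t t' _ IHs _ IHt; rewrite !big_cat IHs IHt.
- by move=> s t; rewrite !big_cat /= addrC.
- move=> Y f g e y; rewrite big_seq1 big_nil /=.
  by apply: (@addrI _ (b e 0 y)); rewrite -balancedDl // !addr0.
- by move=> Y f g e x x' y; rewrite !big_cons !big_nil /= balancedDl // !addr0.
- by move=> Y f g e x y y'; rewrite !big_cons !big_nil /= balancedDr // !addr0.
- by move=> Y f g e c x y; rewrite !big_seq1 /= balancedZ.
- move=> Y Z f g l gf lg e1 e2 e3 e4 m a n; rewrite !big_seq1 /=.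
  exact: balancedA.
Qed.

Fact tens_lift_pi s :
  tens_lift (\pi_(tens h) s) = \sum_(g <- s) b (te g) (tx g) (ty g).
Proof. by apply: tens_lift_eq; apply/tens_piP; rewrite reprK. Qed.

Lemma tens_liftD u v : tens_lift (u + v) = tens_lift u + tens_lift v.
Proof.
elim/quotW: u => s; elim/quotW: v => t.
by rewrite [_ + _]tensD_pi !tens_lift_pi big_cat.
Qed.

Lemma tens_lift0 : tens_lift 0 = 0.
Proof. by rewrite [0]/(tens0 h) tens_lift_pi big_nil. Qed.

Lemma tens_lift_pure Y (f : hom (src h) Y) g (e : arr h = g ∘ f) x y :
  tens_lift (tpure e x y) = b e x y.
Proof. by rewrite tens_lift_pi big_seq1. Qed.
End Lift.

Section TensLmod.
Variable h : mor C.

Definition tensZ_pure (c : k) Y (f : hom (src h) Y) (g : hom Y (tgt h))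
  (e : arr h = g ∘ f) (x : M f) (y : N g) : tens h := tpure e (c *: x) y.

Fact tensZ_bal c : balanced (tensZ_pure c).
Proof.
split=> *; rewrite /tensZ_pure.
- by rewrite scalerDr tpureDl.
- by rewrite tpureDr.
- by rewrite scalerA mulrC -scalerA tpureZlr.
- by rewrite -ractZl scalerA mulrC -scalerA; exact: tpure_bal.
Qed.

Definition tensZ c (u : tens h) : tens h := tens_lift (tensZ_pure c) u.

Fact tensZ0 c : tensZ c 0 = 0.
Proof. exact/tens_lift0/tensZ_bal. Qed.
Fact tensZE c Y (f : hom (src h) Y) (g : hom Y (tgt h)) (e : arr h = g ∘ f)
  (x : M f) (y : N g) : tensZ c (tpure e x y) = tpure e (c *: x) y.
Proof. exact/tens_lift_pure/tensZ_bal. Qed.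

Fact tens_scaleDr : right_distributive tensZ +%R.
Proof. by move=> c u v; apply: tens_liftD; exact: tensZ_bal. Qed.
Fact tens_scaleA c d u : tensZ c (tensZ d u) = tensZ (c * d) u.
Proof.
elim/tens_indp: u => [|u v IHu IHv|Y f g e x y]; first by rewrite !tensZ0.
  by rewrite !tens_scaleDr IHu IHv.
by rewrite !tensZE scalerA.
Qed.
Fact tens_scale1 : left_id 1 tensZ.
Proof.
elim/tens_indp=> [|u v IHu IHv|Y f g e x y]; first by rewrite tensZ0.
  by rewrite tens_scaleDr IHu IHv.
by rewrite tensZE scale1r.
Qed.
Fact tens_scaleDl u : {morph tensZ^~ u : c d / c + d}.
Proof.
move=> c d; elim/tens_indp: u => [|u v IHu IHv|Y f g e x y].
- by rewrite !tensZ0 addr0.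
- by rewrite !tens_scaleDr IHu IHv addrACA.
- by rewrite !tensZE scalerDl tpureDl.
Qed.
HB.instance Definition _ := GRing.Zmodule_isLmodule.Build k (tens h)
  tens_scaleA tens_scale1 tens_scaleDr tens_scaleDl.

Lemma tpureZl c Y (f : hom (src h) Y) (g : hom Y (tgt h)) (e : arr h = g ∘ f)
  (x : M f) (y : N g) : tpure e (c *: x) y = c *: tpure e x y.
Proof. by rewrite [RHS]tensZE. Qed.
Lemma tpureZr c Y (f : hom (src h) Y) (g : hom Y (tgt h)) (e : arr h = g ∘ f)
  (x : M f) (y : N g) : tpure e x (c *: y) = c *: tpure e x y.
Proof. by rewrite -tpureZlr tpureZl. Qed.
End TensLmod.

Lemma tens_lift_linear h (V : lmodType k)
    (b : forall Y (f : hom (src h) Y) (g : hom Y (tgt h)),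
       arr h = g ∘ f -> M f -> N g -> V) :
  balanced b ->
  (forall Y f g e c x y, b Y f g e (c *: x) y = c *: b Y f g e x y) ->
  linear (tens_lift b).
Proof.
move=> bb bZ c u v; rewrite tens_liftD //; congr (_ + _).
elim/tens_indp: u => [|u w IHu IHw|Y f g e x y].
- by rewrite scaler0 !tens_lift0 // scaler0.
- by rewrite scalerDr !tens_liftD // IHu IHw scalerDr.
- by rewrite -tpureZl !tens_lift_pure // bZ.
Qed.

Lemma tens_linear_eq h (V : lmodType k) (p q : tens h -> V) :
  linear p -> linear q ->
  (forall Y (f : hom (src h) Y) g (e : arr h = g ∘ f) x y,
     p (tpure e x y) = q (tpure e x y)) ->
  p =1 q.
Proof.
have lin0 (r : tens h -> V) : linear r -> r 0 = 0.
  by move=> /(_ (-1) 0 0); rewrite scaler0 addr0 scaleN1r addNr.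
have linD (r : tens h -> V) : linear r -> {morph r : u v / u + v}.
  by move=> rl u v; have := rl 1 u v; rewrite !scale1r.
move=> pl ql pq; elim/tens_indp => [|u v IHu IHv|Y f g e x y].
- by rewrite !lin0.
- by rewrite !linD // IHu IHv.
- exact: pq.
Qed.

End Tensor.
Arguments tpure {k C A M N h Y f g} e x y.

Section Units.
Variables (k : comPzRingType) (C : gradingCategory k).

Lemma kunitK (u : kunit k) x : uinv u * (uval u * x) = x.
Proof. by rewrite mulrA [uinv u * _]mulrC uvalV mul1r. Qed.
Lemma kunitVK (u : kunit k) x : uval u * (uinv u * x) = x.
Proof. by rewrite mulrA uvalV mul1r. Qed.
Lemma kunitI (u : kunit k) x y : uval u * x = uval u * y -> x = y.
Proof. by move=> /(congr1 ( *%R (uinv u))); rewrite !kunitK. Qed.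

Lemma alpha_pentagon (X Y Z W V : C) (f1 : hom X Y) (f2 : hom Y Z)
    (f3 : hom Z W) (f4 : hom W V) :
  uval (alpha f1 f2 f3) * uval (alpha f1 (f3 ∘ f2) f4) * uval (alpha f2 f3 f4)
  = uval (alpha f1 f2 (f4 ∘ f3)) * uval (alpha (f2 ∘ f1) f3 f4).
Proof.
have := alpha_cocycle f1 f2 f3 f4.
move: (alpha f1 f2 (f4 ∘ f3)) (alpha (f2 ∘ f1) f3 f4) => b d.
move: (uval (alpha f1 f2 f3)) (uval (alpha f1 (f3 ∘ f2) f4)) => a c.
move: (uval (alpha f2 f3 f4)) => e E.
transitivity (a * c * e * (uval b * uinv b) * (uval d * uinv d)).
  by rewrite !uvalV !mulr1.
by rewrite -[RHS]mulr1 -E; ring.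
Qed.

End Units.

Section TensBimod.
Variables (k : comPzRingType) (C : gradingCategory k) (A : galgebra C).
Variables M N : bimod A.
Local Notation T := (tens M N).

Section Act.
Variables (X Y Z : C) (f : hom X Y) (g : hom Y Z) (h : hom X Z).
Variable e : h = g ∘ f.

Fact tlact_eq W (u : hom Y W) (v : hom W Z) (ev : g = v ∘ u) :
  h = v ∘ (u ∘ f).
Proof. by rewrite e ev compA. Qed.

Definition tlact_pure (a : A f) W (u : hom Y W) (v : hom W Z)
    (ev : g = v ∘ u) (x : M u) (y : N v) : T h :=
  tpure (h := h) (tlact_eq ev) (uinv (alpha f u v) *: lact erefl a x) y.

Fact tlact_bal a : balanced (h := g) (tlact_pure a).
Proof.
split; rewrite /tlact_pure.
- by move=> *; rewrite lactDr scalerDr tpureDl.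
- by move=> *; rewrite tpureDr.
- by move=> *; rewrite lactZr !tpureZl !tpureZr.
move=> W V u v w vu wv e1 e2 e3 e4 m b n.
have e5 : vu ∘ f = v ∘ (u ∘ f) by rewrite e1 compA.
have := lract_assoc (erefl _) e5 e1 (erefl _) a m b.
move/(congr1 (fun x => uinv (alpha f u v) *: x)).
rewrite scalerA [uinv _ * _]mulrC uvalV scale1r => <-.
rewrite scalerA tpureZl (tpure_bal (h := h) e5 _ e3 (tlact_eq e4)).
rewrite lactZr scalerA !tpureZl !scalerA; congr (_ *: _).
have := alpha_pentagon f u v w; rewrite -e1 -e3.
move: (alpha f u v) (alpha f vu w) (alpha f u wv) => p q r.
move: (uval (alpha u v w)) (uval (alpha (u ∘ f) v w)) => s t E.
transitivity (uinv q * uinv p * (uinv r * (uval r * t))).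
  by rewrite kunitK.
rewrite -E.
transitivity (uinv r * s * (uval p * uinv p) * (uval q * uinv q)).
  by ring.
by rewrite !uvalV !mulr1.
Qed.

Definition tlact (a : A f) (t : T g) : T h :=
  tens_lift (h := g) (tlact_pure a) t.

Lemma tlactE (a : A f) W (u : hom Y W) (v : hom W Z) (ev : g = v ∘ u)
    (x : M u) (y : N v) (uf : hom X W) (e1 : uf = u ∘ f) (e2 : h = v ∘ uf) :
  tlact a (tpure (h := g) ev x y)
  = tpure (h := h) e2 (uinv (alpha f u v) *: lact e1 a x) y.
Proof.
rewrite /tlact tens_lift_pure; last exact: tlact_bal.
subst uf; by rewrite /tlact_pure (Prop_irrelevance e2 (tlact_eq ev)).
Qed.

Lemma tlact_linear a : linear (tlact a).
Proof.
apply: tens_lift_linear; first exact: tlact_bal.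
by move=> W u v ev c x y; rewrite /tlact_pure lactZr scalerA mulrC -scalerA tpureZl.
Qed.

Fact tract_eq W (u : hom X W) (v : hom W Y) (ev : f = v ∘ u) :
  h = (g ∘ v) ∘ u.
Proof. by rewrite e ev compA. Qed.

Definition tract_pure (b : A g) W (u : hom X W) (v : hom W Y)
    (ev : f = v ∘ u) (x : M u) (y : N v) : T h :=
  tpure (h := h) (tract_eq ev) (uval (alpha u v g) *: x) (ract erefl y b).

Fact tract_bal b : balanced (h := f) (tract_pure b).
Proof.
split; rewrite /tract_pure.
- by move=> *; rewrite scalerDr tpureDl.
- by move=> *; rewrite ractDl tpureDr.
- by move=> *; rewrite ractZl !tpureZl !tpureZr.
move=> W V u v w vu wv e1 e2 e3 e4 m a n.
have e5 : g ∘ wv = (g ∘ w) ∘ v by rewrite e3 compA.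
have := lract_assoc e3 (erefl _) (erefl _) e5 a n b => ->.
rewrite !tpureZl !tpureZr (tpure_bal (h := h) e1 _ e5 (tract_eq e4)).
rewrite !tpureZl !scalerA; congr (_ *: _).
have := alpha_pentagon u v w g; rewrite -e1 -e3 => E.
by rewrite [LHS]mulrC -E; ring.
Qed.

Definition tract (t : T f) (b : A g) : T h :=
  tens_lift (h := f) (tract_pure b) t.

Lemma tractE (b : A g) W (u : hom X W) (v : hom W Y) (ev : f = v ∘ u)
    (x : M u) (y : N v) (gv : hom W Z) (e1 : gv = g ∘ v) (e2 : h = gv ∘ u) :
  tract (tpure (h := f) ev x y) b
  = tpure (h := h) e2 (uval (alpha u v g) *: x) (ract e1 y b).
Proof.
rewrite /tract tens_lift_pure; last exact: tract_bal.
subst gv; by rewrite /tract_pure (Prop_irrelevance e2 (tract_eq ev)).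
Qed.

Lemma tract_linear b : linear (tract^~ b).
Proof.
apply: tens_lift_linear; first exact: tract_bal.
by move=> W u v ev c x y; rewrite /tract_pure scalerA mulrC -scalerA tpureZl.
Qed.

Fact tlact_bilinear : is_bilinear tlact.
Proof.
split=> [t c a b|a]; last exact: tlact_linear.
have lin0 (p : A f) : tlact p 0 = 0.
  by have := tlact_linear p (-1) 0 0; rewrite scaler0 addr0 scaleN1r addNr.
have linD (p : A f) : {morph tlact p : u v / u + v}.
  by move=> u v; have := tlact_linear p 1 u v; rewrite !scale1r.
elim/tens_indp: t => [|u v IHu IHv|W u v ev x y].
- by rewrite !lin0 scaler0 addr0.
- by rewrite !linD IHu IHv scalerDr addrACA.
rewrite !(tlactE _ _ _ _ (erefl _) (tlact_eq ev)).
rewrite lactDl lactZl scalerDr tpureDl scalerA mulrC -scalerA.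
by rewrite [in LHS]tpureZl.
Qed.

Fact tract_bilinear : is_bilinear tract.
Proof.
split=> [b|t c a b]; first exact: tract_linear.
have lin0 (p : A g) : tract 0 p = 0.
  by have := tract_linear p (-1) 0 0; rewrite scaler0 addr0 scaleN1r addNr.
have linD (p : A g) : {morph tract^~ p : u v / u + v}.
  by move=> u v; have := tract_linear p 1 u v; rewrite !scale1r.
elim/tens_indp: t => [|u v IHu IHv|W u v ev x y].
- by rewrite !lin0 scaler0 addr0.
- by rewrite !linD IHu IHv scalerDr addrACA.
rewrite !(tractE _ _ _ _ (erefl _) (tract_eq ev)).
by rewrite ractDr ractZr tpureDr tpureZr.
Qed.
End Act.
Arguments tlactE {X Y Z f g h} e a {W u v} ev x y {uf} e1 e2.
Arguments tractE {X Y Z f g h} e b {W u v} ev x y {gv} e1 e2.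
Arguments tlact {X Y Z f g h} e a t.
Arguments tract {X Y Z f g h} e t b.

Section Lin.
Variables (X Y Z : C) (f : hom X Y) (g : hom Y Z) (h : hom X Z).
Variable e : h = g ∘ f.
Definition tlactr_of (a : A f) : T g -> T h := tlact e a.
HB.instance Definition _ a := GRing.isLinear.Build k (T g) (T h) *:%R
  (tlactr_of a) ((tlact_bilinear e).2 a).
Definition tractl_of (a : A g) : T f -> T h := (tract e)^~ a.
HB.instance Definition _ a := GRing.isLinear.Build k (T f) (T h) *:%R
  (tractl_of a) ((tract_bilinear e).1 a).
End Lin.

Section Assoc.
Variables (X Y Z W : C) (f : hom X Y) (g : hom Y Z) (h : hom Z W).
Variables (gf : hom X Z) (hg : hom Y W) (l : hom X W).
Variables (e1 : gf = g ∘ f) (e2 : l = h ∘ gf).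
Variables (e3 : hg = h ∘ g) (e4 : l = hg ∘ f).

Fact tlact_assoc (a : A f) (a' : A g) (t : T h) :
  tlact e2 (mu e1 a a') t = uval (alpha f g h) *: tlact e4 a (tlact e3 a' t).
Proof.
move: t; apply: tens_linear_eq.
- exact: linearP (tlactr_of e2 (mu e1 a a')).
- exact: linearP (uval (alpha f g h) \*: (tlactr_of e4 a \o tlactr_of e3 a')).
move=> V u v /= ev x y /=; rewrite /tlactr_of.
have p1 : u ∘ gf = (u ∘ g) ∘ f by rewrite e1 compA.
have p2 : hg = v ∘ (u ∘ g) by rewrite e3 ev compA.
have p3 : l = v ∘ (u ∘ gf) by rewrite e2 ev compA.
rewrite (tlactE e2 _ ev _ _ (erefl _) p3) (tlactE e3 _ ev _ _ (erefl _) p2).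
rewrite (tlactE e4 _ p2 _ _ p1 p3).
rewrite (lact_assoc e1 (erefl _) (erefl _) p1) lactZr !scalerA !tpureZl scalerA.
congr (_ *: _).
have := alpha_pentagon f g u v; rewrite -e1 -ev.
move: (uval (alpha f g u)) (alpha f g h) (alpha f (u ∘ g) v) => p q r.
move: (alpha g u v) (alpha gf u v) => s t E.
transitivity (uinv s * uinv r * uinv t * (p * uval r * uval s)).
  transitivity (uinv t * p * (uval s * uinv s) * (uval r * uinv r)).
    by rewrite !uvalV !mulr1.
  by ring.
rewrite E; transitivity (uval q * (uinv r * uinv s) * (uval t * uinv t)).
  by ring.
by rewrite uvalV mulr1.
Qed.

Fact tract_assoc (t : T f) (b : A g) (b' : A h) :
  tract e2 (tract e1 t b) b' = uval (alpha f g h) *: tract e4 t (mu e3 b b').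
Proof.
move: t; apply: tens_linear_eq.
- exact: linearP (tractl_of e2 b' \o tractl_of e1 b).
- exact: linearP (uval (alpha f g h) \*: tractl_of e4 (mu e3 b b')).
move=> V u v /= ev x y /=; rewrite /tractl_of.
have p1 : hg ∘ v = h ∘ (g ∘ v) by rewrite e3 compA.
have p2 : gf = (g ∘ v) ∘ u by rewrite e1 ev compA.
have p3 : l = (hg ∘ v) ∘ u by rewrite e4 ev compA.
rewrite (tractE e1 _ ev _ _ (erefl _) p2) (tractE e4 _ ev _ _ (erefl _) p3).
rewrite (tractE e2 _ p2 _ _ p1 p3).
rewrite (ract_assoc (erefl _) p1 e3 (erefl _)) !tpureZl tpureZr !scalerA.
congr (_ *: _).
have := alpha_pentagon u v g h; rewrite -e3 -ev => E.
by rewrite [RHS]mulrC -E; ring.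
Qed.

Fact tlract_assoc (a : A f) (t : T g) (b : A h) :
  tract e2 (tlact e1 a t) b = uval (alpha f g h) *: tlact e4 a (tract e3 t b).
Proof.
move: t; apply: tens_linear_eq.
- exact: linearP (tractl_of e2 b \o tlactr_of e1 a).
- exact: linearP (uval (alpha f g h) \*: (tlactr_of e4 a \o tractl_of e3 b)).
move=> V u v /= ev x y /=; rewrite /tractl_of /tlactr_of.
have p1 : gf = v ∘ (u ∘ f) by rewrite e1 ev compA.
have p2 : hg = (h ∘ v) ∘ u by rewrite e3 ev compA.
have p3 : l = (h ∘ v) ∘ (u ∘ f) by rewrite e4 p2 compA.
rewrite (tlactE e1 _ ev _ _ (erefl _) p1) (tractE e3 _ ev _ _ (erefl _) p2).
rewrite (tractE e2 _ p1 _ _ (erefl _) p3) (tlactE e4 _ p2 _ _ (erefl _) p3).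
rewrite lactZr !tpureZl !scalerA; congr (_ *: _).
have := alpha_pentagon f u v h; rewrite -ev.
move: (alpha f u v) (uval (alpha f g h)) (alpha f u (h ∘ v)) => p q r.
move: (uval (alpha u v h)) (uval (alpha (u ∘ f) v h)) => s t E.
transitivity (uinv p * uinv r * (uval r * t)).
  transitivity (t * uinv p * (uval r * uinv r)); last by ring.
  by rewrite uvalV mulr1.
rewrite -E; transitivity (q * uinv r * s * (uval p * uinv p)); first by ring.
by rewrite uvalV; ring.
Qed.
End Assoc.

Fact tlact_1 (X Y : C) (f : hom X Y) (e : f = f ∘ idm X) (t : T f) :
  tlact e (one A X) t = uinv (alpha (idm X) (idm X) f) *: t.
Proof.
move: t; apply: tens_linear_eq.
- exact: linearP (tlactr_of e (one A X)).
- by move=> c x y; rewrite scalerDr !scalerA mulrC.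
move=> V u v /= ev x y; rewrite (tlactE e _ ev _ _ (esym (comp_idr u)) ev).
rewrite lact_1 scalerA tpureZl; congr (_ *: _).
have := alpha_pentagon (idm X) (idm X) u v; rewrite -ev !comp_idr.
move: (alpha (idm X) (idm X) u) (alpha (idm X) u v) => p q.
move: (alpha (idm X) (idm X) f) => r E.
have {}E : uval p * uval q = uval r.
  by apply: (kunitI (u := q)); rewrite mulrC E mulrC.
apply: (kunitI (u := r)); rewrite uvalV -E.
transitivity ((uval p * uinv p) * (uval q * uinv q)); first by ring.
by rewrite !uvalV mulr1.
Qed.

Fact tract_1 (X Y : C) (f : hom X Y) (e : f = idm Y ∘ f) (t : T f) :
  tract e t (one A Y) = uval (alpha f (idm Y) (idm Y)) *: t.
Proof.
move: t; apply: tens_linear_eq.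
- exact: linearP (tractl_of e (one A Y)).
- by move=> c x y; rewrite scalerDr !scalerA mulrC.
move=> V u v /= ev x y; rewrite (tractE e _ ev _ _ (esym (comp_idl v)) ev).
rewrite ract_1 tpureZr tpureZl scalerA; congr (_ *: _).
have := alpha_pentagon u v (idm Y) (idm Y); rewrite -ev !comp_idl => E.
by apply: (kunitI (u := alpha u v (idm Y))); rewrite -E; ring.
Qed.

Definition tens_bimod : bimod A :=
  Bimod (fun _ _ _ _ _ _ e => tlact_bilinear e)
    (fun _ _ _ _ _ _ e => tract_bilinear e)
    tlact_assoc tract_assoc tlract_assoc tlact_1 tract_1.
End TensBimod.

Section TensMap.
Variables (k : comPzRingType) (C : gradingCategory k) (A : galgebra C).
Variables (M M' N N' : bimod A) (u : bimhom M M') (v : bimhom N N').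

Definition tmap_pure (h : mor C) Y (f : hom (src h) Y) (g : hom Y (tgt h))
  (e : arr h = g ∘ f) (x : M f) (y : N g) : tens M' N' h :=
  tpure e (bfun u x) (bfun v y).

Fact tmap_bal h : balanced (@tmap_pure h).
Proof.
split; rewrite /tmap_pure.
- by move=> *; rewrite linearD tpureDl.
- by move=> *; rewrite linearD tpureDr.
- by move=> *; rewrite !linearZ /= tpureZl tpureZr.
- move=> Y Z f g l gf lg e1 e2 e3 e4 m a n.
  by rewrite bfun_ract bfun_lact linearZ; exact: tpure_bal.
Qed.

Definition tmap_fun (h : mor C) : tens M N h -> tens M' N' h :=
  tens_lift (@tmap_pure h).

Lemma tmap_funE (h : mor C) Y (f : hom (src h) Y) (g : hom Y (tgt h))
    (e : arr h = g ∘ f) (x : M f) (y : N g) :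
  tmap_fun (tpure e x y) = tpure e (bfun u x) (bfun v y).
Proof. by rewrite /tmap_fun tens_lift_pure //; exact: tmap_bal. Qed.

Fact tmap_linear h : linear (@tmap_fun h).
Proof.
apply: tens_lift_linear; first exact: tmap_bal.
by move=> *; rewrite /tmap_pure linearZ /= tpureZl.
Qed.
HB.instance Definition _ h := GRing.isLinear.Build k _ _ *:%R
  (@tmap_fun h) (@tmap_linear h).

Definition tmap : bimhom (tens_bimod M N) (tens_bimod M' N').
Proof.
exists tmap_fun; first exact: tmap_linear.
- move=> X Y Z f g h e a t; move: t; apply: tens_linear_eq.
  + exact: linearP (@tmap_fun h \o tlactr_of e a).
  + exact: linearP (tlactr_of e a \o @tmap_fun g).
  move=> V p q /= ev x y; rewrite /tlactr_of tmap_funE.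
  have e2 : h = q ∘ (p ∘ f) by rewrite e ev compA.
  rewrite !(tlactE e _ ev _ _ (erefl _) e2) tmap_funE.
  by rewrite linearZ /= bfun_lact.
- move=> X Y Z f g h e t a; move: t; apply: tens_linear_eq.
  + exact: linearP (@tmap_fun h \o tractl_of e a).
  + exact: linearP (tractl_of e a \o @tmap_fun f).
  move=> V p q /= ev x y; rewrite /tractl_of tmap_funE.
  have e2 : h = (g ∘ q) ∘ p by rewrite e ev compA.
  rewrite !(tractE e _ ev _ _ (erefl _) e2) tmap_funE.
  by rewrite linearZ /= bfun_ract.
Defined.
End TensMap.

Section TensMapTheory.
Variables (k : comPzRingType) (C : gradingCategory k) (A : galgebra C).

Lemma tmap_fun_eq (M M' N N' : bimod A) (u u' : bimhom M M')
    (v v' : bimhom N N') h (t : tens M N h) :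
  (forall f (x : M f), bfun u x = bfun u' x) ->
  (forall f (x : N f), bfun v x = bfun v' x) ->
  tmap_fun u v t = tmap_fun u' v' t.
Proof. by move=> /bimhom_eq-> /bimhom_eq->. Qed.

Lemma tmap_fun_comp (M M' M2 N N' N2 : bimod A) (u : bimhom M M')
    (u' : bimhom M' M2) (v : bimhom N N') (v' : bimhom N' N2) h
    (t : tens M N h) :
  tmap_fun u' v' (tmap_fun u v t) = tmap_fun (bimcomp u' u) (bimcomp v' v) t.
Proof.
move: t; apply: tens_linear_eq => [||Y f g e x y].
- exact: linearP (@tmap_fun _ _ _ _ _ _ _ u' v' h \o @tmap_fun _ _ _ _ _ _ _ u v h).
- exact: tmap_linear.
- by rewrite !tmap_funE.
Qed.

Lemma tmap_fun0l (M M' N N' : bimod A) (u : bimhom M M') (v : bimhom N N') h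
    (t : tens M N h) :
  (forall f (x : M f), bfun u x = 0) -> tmap_fun u v t = 0.
Proof.
move=> u0; elim/tens_indp: t => [|s t IHs IHt|Y f g e x y].
- by rewrite linear0.
- by rewrite linearD /= IHs IHt addr0.
- by rewrite tmap_funE u0 tpure0l.
Qed.

Lemma tmap_fun0r (M M' N N' : bimod A) (u : bimhom M M') (v : bimhom N N') h
    (t : tens M N h) :
  (forall f (x : N f), bfun v x = 0) -> tmap_fun u v t = 0.
Proof.
move=> v0; elim/tens_indp: t => [|s t IHs IHt|Y f g e x y].
- by rewrite linear0.
- by rewrite linearD /= IHs IHt addr0.
- by rewrite tmap_funE v0 tpure0r.
Qed.
End TensMapTheory.

Section Complexes.
Variables (k : comPzRingType) (C : gradingCategory k) (A : galgebra C).

(* As for the product of an algebra, the differential M^i -> M^(i+1) takes the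
   equation j = i + 1 as an argument. *)
Record complex := Complex {
  cobj :> int -> bimod A;
  cd : forall i j : int, j = i + 1 -> bimhom (cobj i) (cobj j);
  cd_cd : forall (i j l : int) (e : j = i + 1) (e' : l = j + 1)
    (f : mor C) (x : cobj i f), bfun (cd e') (bfun (cd e) x) = 0;
  cbounded : exists b : nat, forall i : int, (b < `|i|)%N ->
    forall (f : mor C) (x : cobj i f), x = 0 }.

Record chmap (M N : complex) := Chmap {
  cmap : forall i : int, bimhom (M i) (N i);
  cmap_cd : forall (i j : int) (e : j = i + 1) (f : mor C) (x : M i f),
    bfun (cmap j) (bfun (cd M e) x) = bfun (cd N e) (bfun (cmap i) x) }.

Lemma chmap_eq (M N : complex) (u v : chmap M N) :
  (forall i f (x : M i f), bfun (cmap u i) x = bfun (cmap v i) x) -> u = v.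
Proof.
case: u v => [u ul] [v vl] /= uv.
have E : u = v.
  by apply: functional_extensionality_dep => i; apply: bimhom_eq => f x.
case: v / E {uv} vl => vl.
by congr Chmap; apply: Prop_irrelevance.
Qed.

HB.instance Definition _ (M N : complex) := gen_eqMixin (chmap M N).
HB.instance Definition _ (M N : complex) := gen_choiceMixin (chmap M N).

Section ChmapLmod.
Variables M N : complex.
Implicit Types (c d : k) (u v w : chmap M N).

Definition chmap0 : chmap M N.
Proof. by exists (fun=> 0) => i j e f x; rewrite !bfun0 linear0. Defined.
Definition chmapD u v : chmap M N.
Proof.
exists (fun i => cmap u i + cmap v i) => i j e f x.
by rewrite !bfunD linearD !cmap_cd.
Defined.
Definition chmapZ c u : chmap M N.
Proof.
exists (fun i => c *: cmap u i) => i j e f x.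
by rewrite !bfunZ linearZ cmap_cd.
Defined.
Definition chmapN u := chmapZ (-1) u.

Fact chmap_addA : associative chmapD.
Proof. by move=> u v w; apply: chmap_eq => i f x /=; rewrite addrA. Qed.
Fact chmap_addC : commutative chmapD.
Proof. by move=> u v; apply: chmap_eq => i f x /=; rewrite addrC. Qed.
Fact chmap_add0 : left_id chmap0 chmapD.
Proof. by move=> u; apply: chmap_eq => i f x /=; rewrite add0r. Qed.
Fact chmap_addN : left_inverse chmap0 chmapN chmapD.
Proof. by move=> u; apply: chmap_eq => i f x /=; rewrite scaleN1r addNr. Qed.
HB.instance Definition _ := GRing.isZmodule.Build (chmap M N)
  chmap_addA chmap_addC chmap_add0 chmap_addN.

Fact chmap_scaleA c d u : chmapZ c (chmapZ d u) = chmapZ (c * d) u.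
Proof. by apply: chmap_eq => i f x /=; rewrite scalerA. Qed.
Fact chmap_scale1 : left_id 1 chmapZ.
Proof. by move=> u; apply: chmap_eq => i f x /=; rewrite scale1r. Qed.
Fact chmap_scaleDr : right_distributive chmapZ +%R.
Proof. by move=> c u v; apply: chmap_eq => i f x /=; rewrite scalerDr. Qed.
Fact chmap_scaleDl u : {morph chmapZ^~ u : c d / c + d}.
Proof. by move=> c d; apply: chmap_eq => i f x /=; rewrite scalerDl. Qed.
HB.instance Definition _ := GRing.Zmodule_isLmodule.Build k (chmap M N)
  chmap_scaleA chmap_scale1 chmap_scaleDr chmap_scaleDl.

Lemma cmapD u v i : cmap (u + v) i = cmap u i + cmap v i.
Proof. by []. Qed.
Lemma cmapZ c u i : cmap (c *: u) i = c *: cmap u i.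
Proof. by []. Qed.
Lemma cmap0 i : cmap (0 : chmap M N) i = 0.
Proof. by []. Qed.
Lemma cmapN u i : cmap (- u) i = - cmap u i.
Proof. by rewrite -scaleN1r cmapZ scaleN1r. Qed.
End ChmapLmod.

Definition chid (M : complex) : chmap M M.
Proof. by exists (fun i => bimid (M i)). Defined.

Definition chcomp (M N P : complex) (v : chmap N P) (u : chmap M N) :
  chmap M P.
Proof.
exists (fun i => bimcomp (cmap v i) (cmap u i)) => i j e f x /=.
by rewrite !cmap_cd.
Defined.

Definition homotopic (M N : complex) (u v : chmap M N) : Prop :=
  exists s : forall i j : int, j = i + 1 -> bimhom (M j) (N i),
    forall (i j l : int) (e : j = i + 1) (e' : l = j + 1) (f : mor C)
      (x : M j f),
    bfun (cmap u j) x - bfun (cmap v j) x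
    = bfun (cd N e) (bfun (s i j e) x) + bfun (s j l e') (bfun (cd M e') x).

Definition nullhom (M N : complex) : {pred chmap M N} :=
  fun u => `[< homotopic u 0 >].

Section Nullhom.
Variables M N : complex.

Lemma nullhomP (u : chmap M N) : reflect (homotopic u 0) (u \in @nullhom M N).
Proof. exact: asboolP. Qed.

Lemma homotopicE (u v : chmap M N) : homotopic u v <-> homotopic (u - v) 0.
Proof.
split=> -[s us]; exists s => i j l e e' f x; rewrite -us.
  by rewrite cmapD cmapN bfunD bfunN cmap0 bfun0 subr0.
by rewrite cmapD cmapN bfunD bfunN cmap0 bfun0 subr0.
Qed.

Fact nullhomZ c (u : chmap M N) : homotopic u 0 -> homotopic (c *: u) 0.
Proof.
move=> [s us]; exists (fun i j e => c *: s i j e) => i j l e e' f x.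
have := us _ _ _ e e' f x; rewrite !cmap0 !bfun0 !subr0 => E.
by rewrite cmapZ !bfunZ E scalerDr linearZ.
Qed.

Fact nullhom_zmod_closed : zmod_closed (@nullhom M N).
Proof.
split=> [|u v].
  apply/nullhomP; exists (fun _ _ _ => 0) => i j l e e' f x.
  by rewrite !cmap0 !bfun0 subr0 linear0 addr0.
move=> /nullhomP[s us] /nullhomP[t vt]; apply/nullhomP.
exists (fun i j e => s i j e - t i j e) => i j l e e' f x.
have := us _ _ _ e e' f x; have := vt _ _ _ e e' f x.
rewrite !cmap0 !bfun0 !subr0 cmapD cmapN !bfunD !bfunN => -> ->.
by rewrite linearB opprD addrACA.
Qed.
HB.instance Definition _ :=
  GRing.isZmodClosed.Build (chmap M N) (@nullhom M N) nullhom_zmod_closed.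

Definition homK := Quotient.quot (@nullhom M N).
HB.instance Definition _ := Choice.on homK.
HB.instance Definition _ := EqQuotient.on homK.
HB.instance Definition _ := GRing.Zmodule.on homK.

Lemma homK_piP (u v : chmap M N) :
  reflect (homotopic u v) (\pi_homK u == \pi_homK v).
Proof.
rewrite piE Quotient.equivE.
by have [a b] := homotopicE u v; exact: (iffP (nullhomP _) b a).
Qed.

Definition scaleK c (u : homK) : homK := \pi_homK (c *: repr u).

Lemma scaleK_pi c u : scaleK c (\pi_homK u) = \pi_homK (c *: u).
Proof.
have /homotopicE uu : homotopic (repr (\pi_homK u)) u.
  by apply/homK_piP; rewrite reprK.
by apply/eqP/homK_piP/homotopicE; rewrite -scalerBr; exact: nullhomZ.
Qed.

Lemma homK_piD u v : \pi_homK u + \pi_homK v = \pi_homK (u + v).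
Proof. by symmetry; exact: Quotient.pi_add. Qed.

Fact homK_scaleA c d u : scaleK c (scaleK d u) = scaleK (c * d) u.
Proof. by elim/quotW: u => u; rewrite (scaleK_pi d u) !scaleK_pi scalerA. Qed.
Fact homK_scale1 : left_id 1 scaleK.
Proof. by elim/quotW=> u; rewrite scaleK_pi scale1r. Qed.
Fact homK_scaleDr : right_distributive scaleK +%R.
Proof.
move=> c; elim/quotW=> u; elim/quotW=> v.
by rewrite homK_piD (scaleK_pi c u) (scaleK_pi c v) scaleK_pi homK_piD scalerDr.
Qed.
Fact homK_scaleDl u : {morph scaleK^~ u : c d / c + d}.
Proof.
elim/quotW: u => u c d.
by rewrite (scaleK_pi c u) (scaleK_pi d u) scaleK_pi homK_piD scalerDl.
Qed.
HB.instance Definition _ := GRing.Zmodule_isLmodule.Build k homK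
  homK_scaleA homK_scale1 homK_scaleDr homK_scaleDl.
End Nullhom.

Definition idK (M : complex) : homK M M := \pi_(homK M M) (chid M).

Definition compK (M N P : complex) (v : homK N P) (u : homK M N) : homK M P :=
  \pi_(homK M P) (chcomp (repr v) (repr u)).

Lemma chcomp_homotopic (M N P : complex) (v v' : chmap N P) (u u' : chmap M N) :
  homotopic v v' -> homotopic u u' -> homotopic (chcomp v u) (chcomp v' u').
Proof.
move=> [s vs] [t ut].
exists (fun i j e => bimcomp (s i j e) (cmap u j) + bimcomp (cmap v' i) (t i j e)).
move=> i j l e e' f x; rewrite !bfunD /= linearD /=.
rewrite -(subrKA (bfun (cmap v' j) (bfun (cmap u j) x))) (vs i j l e e') -linearB /=.
rewrite (ut i j l e e') linearD /= !cmap_cd.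
by rewrite addrACA.
Qed.

Lemma compK_pi (M N P : complex) (v : chmap N P) (u : chmap M N) :
  compK (\pi_(homK N P) v) (\pi_(homK M N) u) = \pi_(homK M P) (chcomp v u).
Proof.
by apply/eqP/homK_piP/chcomp_homotopic; apply/homK_piP; rewrite reprK.
Qed.

Lemma compKA (M N P Q : complex) (w : homK P Q) (v : homK N P) (u : homK M N) :
  compK w (compK v u) = compK (compK w v) u.
Proof.
elim/quotW: u => u; elim/quotW: v => v; elim/quotW: w => w.
rewrite (compK_pi v u) (compK_pi w v) !compK_pi; congr (\pi_(homK M Q) _).
exact: chmap_eq.
Qed.

Lemma comp1K (M N : complex) (u : homK M N) : compK (idK N) u = u.
Proof.
elim/quotW: u => u; rewrite compK_pi; congr (\pi_(homK M N) _).
exact: chmap_eq.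
Qed.

Lemma compK1 (M N : complex) (u : homK M N) : compK u (idK M) = u.
Proof.
elim/quotW: u => u; rewrite compK_pi; congr (\pi_(homK M N) _).
exact: chmap_eq.
Qed.

Definition isoK (M N : complex) : Prop :=
  exists (u : homK M N) (v : homK N M), compK v u = idK M /\ compK u v = idK N.

Definition autK (M : complex) :=
  {u : homK M M | `[< exists v, compK v u = idK M /\ compK u v = idK M >]}.
HB.instance Definition _ M := Choice.on (autK M).

Section AutK.
Variable M : complex.
Implicit Types u v w : autK M.

Lemma autK_inv_ex u :
  exists p, compK p (val u) = idK M /\ compK (val u) p = idK M.
Proof. exact/asboolP/(valP u). Qed.

Definition autK1 : autK M.
Proof. by exists (idK M); apply/asboolP; exists (idK M); rewrite comp1K. Defined.

Definition autKM u v : autK M.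
Proof.
exists (compK (val u) (val v)); apply/asboolP.
have [u' [uu' u'u]] := autK_inv_ex u; have [v' [vv' v'v]] := autK_inv_ex v.
exists (compK v' u'); split.
  by rewrite compKA -(compKA v') uu' compK1.
by rewrite compKA -(compKA (val u)) v'v compK1.
Defined.

Definition autKV u : autK M.
Proof.
exists (projT1 (cid (autK_inv_ex u))); apply/asboolP; exists (val u).
by case: cid => v [? ?].
Defined.

Fact autK_mulA : associative autKM.
Proof. by move=> u v w; apply: val_inj; rewrite /= compKA. Qed.
Fact autK_mul1 : left_id autK1 autKM.
Proof. by move=> u; apply: val_inj; rewrite /= comp1K. Qed.
Fact autK_1mul : right_id autK1 autKM.
Proof. by move=> u; apply: val_inj; rewrite /= compK1. Qed.
Fact autK_mulV : left_inverse autK1 autKV autKM.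
Proof. by move=> u; apply: val_inj => /=; case: cid => v []. Qed.
Fact autK_Vmul : right_inverse autK1 autKV autKM.
Proof. by move=> u; apply: val_inj => /=; case: cid => v []. Qed.
HB.instance Definition _ := isGroup.Build (autK M)
  autK_mulA autK_mul1 autK_1mul autK_mulV autK_Vmul.
End AutK.

Definition single (B : bimod A) : complex.
Proof.
exists (fun i => if i == 0 then B else zero_bimod A) (fun _ _ _ => 0).
- by [].
- exists 0%N => i; rewrite absz_gt0 => /negPf -> f x.
  exact: zero_bimod_eq.
Defined.
End Complexes.

Section Total.
Variables (k : comPzRingType) (C : gradingCategory k) (A : galgebra C).
Variables M N : complex A.
Local Notation T i j := (tens_bimod (M i) (N j)).

(* The component of degree f of (M ⊗_A N)^n, the direct sum of the
   M^i ⊗_A N^j with i + j = n: families indexed by all pairs (i, j), supported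
   on this line. Only finitely many of these terms are nonzero since M and N
   are bounded. *)
Record totc (n : int) (f : mor C) := Totc {
  tval : forall i j : int, T i j f;
  tsupp : forall i j : int, i + j <> n -> tval i j = 0 }.

Section TotLmod.
Variables (n : int) (f : mor C).
Implicit Types (c d : k) (t u v : totc n f).

Lemma totc_eq t u : (forall i j, tval t i j = tval u i j) -> t = u.
Proof.
case: t u => [t tP] [u uP] /= tu.
have E : t = u.
  by do 2 (apply: functional_extensionality_dep => ?); exact: tu.
case: u / E {tu} uP => uP.
by congr Totc; apply: Prop_irrelevance.
Qed.

HB.instance Definition _ := gen_eqMixin (totc n f).
HB.instance Definition _ := gen_choiceMixin (totc n f).

Definition totc0 : totc n f.
Proof. by exists (fun _ _ => 0). Defined.
Definition totcD t u : totc n f.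
Proof.
exists (fun i j => tval t i j + tval u i j) => i j ij.
by rewrite !tsupp // addr0.
Defined.
Definition totcZ c t : totc n f.
Proof.
exists (fun i j => c *: tval t i j) => i j ij.
by rewrite tsupp // scaler0.
Defined.
Definition totcN t := totcZ (-1) t.

Fact totc_addA : associative totcD.
Proof. by move=> t u v; apply: totc_eq => i j /=; rewrite addrA. Qed.
Fact totc_addC : commutative totcD.
Proof. by move=> t u; apply: totc_eq => i j /=; rewrite addrC. Qed.
Fact totc_add0 : left_id totc0 totcD.
Proof. by move=> t; apply: totc_eq => i j /=; rewrite add0r. Qed.
Fact totc_addN : left_inverse totc0 totcN totcD.
Proof. by move=> t; apply: totc_eq => i j /=; rewrite scaleN1r addNr. Qed.
HB.instance Definition _ := GRing.isZmodule.Build (totc n f)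
  totc_addA totc_addC totc_add0 totc_addN.

Fact totc_scaleA c d t : totcZ c (totcZ d t) = totcZ (c * d) t.
Proof. by apply: totc_eq => i j /=; rewrite scalerA. Qed.
Fact totc_scale1 : left_id 1 totcZ.
Proof. by move=> t; apply: totc_eq => i j /=; rewrite scale1r. Qed.
Fact totc_scaleDr : right_distributive totcZ +%R.
Proof. by move=> c t u; apply: totc_eq => i j /=; rewrite scalerDr. Qed.
Fact totc_scaleDl t : {morph totcZ^~ t : c d / c + d}.
Proof. by move=> c d; apply: totc_eq => i j /=; rewrite scalerDl. Qed.
HB.instance Definition _ := GRing.Zmodule_isLmodule.Build k (totc n f)
  totc_scaleA totc_scale1 totc_scaleDr totc_scaleDl.

Lemma tvalD t u i j : tval (t + u) i j = tval t i j + tval u i j.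
Proof. by []. Qed.
Lemma tvalZ c t i j : tval (c *: t) i j = c *: tval t i j.
Proof. by []. Qed.
Lemma tval0 i j : tval (0 : totc n f) i j = 0.
Proof. by []. Qed.
End TotLmod.

Section TotBimod.
Variable n : int.

Definition tot_lact (X Y Z : C) (f : hom X Y) (g : hom Y Z) (h : hom X Z)
  (e : h = g ∘ f) (a : A f) (t : totc n g) : totc n h.
Proof.
exists (fun i j => lact e a (tval t i j)) => i j ij.
by rewrite tsupp // lact0r.
Defined.

Definition tot_ract (X Y Z : C) (f : hom X Y) (g : hom Y Z) (h : hom X Z)
  (e : h = g ∘ f) (t : totc n f) (a : A g) : totc n h.
Proof.
exists (fun i j => ract e (tval t i j) a) => i j ij.
by rewrite tsupp // ract0l.
Defined.

Definition tot_bimod : bimod A.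
Proof.
exists (totc n) tot_lact tot_ract.
- move=> X Y Z f g h e; split=> [t|a] c x y; apply: totc_eq => i j.
    exact: (lact_bilinear (T i j) e).1.
  exact: (lact_bilinear (T i j) e).2.
- move=> X Y Z f g h e; split=> [a|t] c x y; apply: totc_eq => i j.
    exact: (ract_bilinear (T i j) e).1.
  exact: (ract_bilinear (T i j) e).2.
- move=> X Y Z W f g h gf hg l e1 e2 e3 e4 a a' t; apply: totc_eq => i j.
  exact: (@lact_assoc _ _ _ (T i j)).
- move=> X Y Z W f g h gf hg l e1 e2 e3 e4 t b b'; apply: totc_eq => i j.
  exact: (@ract_assoc _ _ _ (T i j)).
- move=> X Y Z W f g h gf hg l e1 e2 e3 e4 a t b; apply: totc_eq => i j.
  exact: (@lract_assoc _ _ _ (T i j)).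
- by move=> X Y f e t; apply: totc_eq => i j; exact: (@lact_1 _ _ _ (T i j)).
- by move=> X Y f e t; apply: totc_eq => i j; exact: (@ract_1 _ _ _ (T i j)).
Defined.
End TotBimod.

Definition cdp (P : complex A) (i : int) : bimhom (P (i - 1)) (P i) :=
  cd P (esym (subrK 1 i)).

Definition tot_d_val (n : int) (f : mor C) (t : totc n f) (i j : int) :
    T i j f :=
  bfun (tmap (cdp M i) (bimid (N j))) (tval t (i - 1) j)
  + (-1) ^+ `|i|%N *: bfun (tmap (bimid (M i)) (cdp N j)) (tval t i (j - 1)).

Fact tot_d_linear n f i j : linear (fun t : totc n f => tot_d_val t i j).
Proof.
move=> c t u; rewrite /tot_d_val !tvalD !tvalZ !linearP.
by rewrite scalerDr addrACA.
Qed.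

Fact tot_d_lact n (X Y Z : C) (f : hom X Y) (g : hom Y Z) (h : hom X Z)
    (e : h = g ∘ f) (a : A f) (t : totc n g) i j :
  tot_d_val (tot_lact e a t) i j = lact e a (tot_d_val t i j).
Proof. by rewrite /tot_d_val lactDr lactZr -!bfun_lact. Qed.

Fact tot_d_ract n (X Y Z : C) (f : hom X Y) (g : hom Y Z) (h : hom X Z)
    (e : h = g ∘ f) (t : totc n f) (a : A g) i j :
  tot_d_val (tot_ract e t a) i j = ract e (tot_d_val t i j) a.
Proof. by rewrite /tot_d_val ractDl ractZl -!bfun_ract. Qed.

Fact tot_d_supp (m n : int) (e : n = m + 1) f (t : totc m f) i j :
  i + j <> n -> tot_d_val t i j = 0.
Proof.
move=> ij; have ijm : i + j <> m + 1 by rewrite -e.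
rewrite /tot_d_val !tsupp ?linear0 ?scaler0 ?addr0 //.
  by move=> E; apply: ijm; rewrite -E addrA subrK.
by move=> E; apply: ijm; rewrite -E addrAC subrK.
Qed.

Definition tot_d (m n : int) (e : n = m + 1) :
  bimhom (tot_bimod m) (tot_bimod n).
Proof.
exists (fun f t => Totc (@tot_d_supp m n e f t)).
- by move=> f c t u; apply: totc_eq => i j; exact: tot_d_linear.
- by move=> X Y Z f g h e' a t; apply: totc_eq => i j; exact: tot_d_lact.
- by move=> X Y Z f g h e' t a; apply: totc_eq => i j; exact: tot_d_ract.
Defined.

Fact cdp_cdp (P : complex A) (i : int) f (x : P (i - 1 - 1) f) :
  bfun (cdp P i) (bfun (cdp P (i - 1)) x) = 0.
Proof. exact: cd_cd. Qed.

Fact signB1 (i : int) : (-1) ^+ `|i - 1|%N = - (-1) ^+ `|i|%N :> k.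
Proof.
case: i => [[|i]|i]; first by rewrite expr1 expr0.
  by rewrite -addn1 PoszD addrK exprD expr1 mulrN1 opprK.
by rewrite NegzE -opprD -PoszD !abszN !absz_nat addn1 exprS mulN1r.
Qed.

Fact tot_dd (m n p : int) (e : n = m + 1) (e' : p = n + 1) f (t : totc m f) :
  bfun (tot_d e') (bfun (tot_d e) t) = 0.
Proof.
apply: totc_eq => i j; rewrite tval0.
rewrite -[LHS]/(tot_d_val (bfun (tot_d e) t) i j) /tot_d_val.
rewrite -[tval _ (i - 1) j]/(tot_d_val t (i - 1) j).
rewrite -[tval _ i (j - 1)]/(tot_d_val t i (j - 1)) /tot_d_val.
rewrite !linearD !linearZ /= !tmap_fun_comp.
rewrite (tmap_fun0l (u := bimcomp (cdp M i) _) _ _ (@cdp_cdp M i)).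
rewrite (tmap_fun0r (v := bimcomp (cdp N j) _) _ _ (@cdp_cdp N j)).
rewrite !scaler0 add0r addr0 signB1 scaleNr; apply/eqP.
by rewrite addrC subr_eq0; apply/eqP; congr (_ *: _); exact: tmap_fun_eq.
Qed.

Fact tot_bounded : exists b : nat, forall n : int, (b < `|n|)%N ->
  forall (f : mor C) (x : tot_bimod n f), x = 0.
Proof.
have [b Mb] := cbounded M; have [c Nc] := cbounded N.
exists (b + c)%N => n bcn f x; apply: totc_eq => i j; rewrite tval0.
have [ijn|/eqP ijn] := eqVneq (i + j) n; last exact: tsupp.
have [bi|ib] := ltnP b `|i|%N.
  elim/tens_indp: (tval x i j) => // [u v -> ->|Y g l el y z].
    by rewrite addr0.
  by rewrite (Mb i bi _ y) tpure0l.
have cj : (c < `|j|)%N.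
  rewrite ltnNge; apply/negP => jc; move: bcn; rewrite -ijn ltnNge.
  rewrite (@leq_trans (`|i| + `|j|)%N) ?leq_add //.
  by rewrite -lez_nat PoszD !abszE ler_normD.
elim/tens_indp: (tval x i j) => // [u v -> ->|Y g l el y z].
  by rewrite addr0.
by rewrite (Nc j cj _ z) tpure0r.
Qed.

Definition tot : complex A :=
  @Complex k C A tot_bimod tot_d tot_dd tot_bounded.
End Total.

Definition invertible (k : comPzRingType) (C : gradingCategory k)
    (A : galgebra C) (M : complex A) : Prop :=
  exists N : complex A,
    isoK (tot N M) (single (regular A)) /\ isoK (tot M N) (single (regular A)).

Section Center.
Variables (k : comPzRingType) (C : gradingCategory k) (A : galgebra C).

(* A formal sum of elements z_X of degree Id_X is a family. For |a| : X -> Y,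
   mu(a, z) and mu(z, a) are mu(a, z_Y) and mu(z_X, a). *)
Definition in_center (z : forall X : C, A (idm X)) : Prop :=
  forall (X Y : C) (g : hom X Y) (el : g = idm Y ∘ g) (er : g = g ∘ idm X)
      (a : A g),
    mu el a (z Y)
    = (uval (alpha (idm X) (idm X) g) * uval (alpha g (idm Y) (idm Y)))
      *: mu er (z X) a.

Definition zmul (z z' : forall X : C, A (idm X)) (X : C) : A (idm X) :=
  mu (esym (comp_idl (idm X))) (z X) (z' X).

Definition Zstar :=
  {z : forall X : C, A (idm X) |
    `[< in_center z /\ exists z', in_center z' /\ zmul z z' = one A >]}.
HB.instance Definition _ := Choice.on Zstar.

Implicit Types z w v : forall X : C, A (idm X).

Fact alpha_id2 (X Y : C) (g : hom X Y) : uval (alpha (idm X) g (idm Y)) = 1.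
Proof.
have := alpha_cocycle (idm X) g (idm Y) (idm Y).
rewrite !comp_idl !comp_idr uvalV mul1r => E.
by rewrite -[RHS]E -mulrA [uinv _ * _]mulrC uvalV mulr1.
Qed.

Fact in_center_one : in_center (one A).
Proof.
move=> X Y g el er a; rewrite mu_1l mu_1r scalerA; congr (_ *: _).
by rewrite mulrAC uvalV mul1r.
Qed.

Fact uinv_id3 (X : C) : uinv (alpha (idm X) (idm X) (idm X)) = 1.
Proof. by have := uvalV (alpha (idm X) (idm X) (idm X)); rewrite alpha_id2 mul1r. Qed.

Fact zmulE z w (X : C) (e : idm X = idm X ∘ idm X) :
  zmul z w X = mu e (z X) (w X).
Proof. by rewrite /zmul (Prop_irrelevance e (esym (comp_idl (idm X)))). Qed.

Fact zmulA z w v : zmul z (zmul w v) = zmul (zmul z w) v.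
Proof.
apply: functional_extensionality_dep => X; have e := esym (comp_idl (idm X)).
by rewrite !(zmulE _ _ e) (mu_assoc e e e e) alpha_id2 scale1r.
Qed.

Fact zmul1 z : zmul (one A) z = z.
Proof.
apply: functional_extensionality_dep => X.
by rewrite /zmul mu_1l uinv_id3 scale1r.
Qed.

Fact zmul1r z : zmul z (one A) = z.
Proof.
apply: functional_extensionality_dep => X.
by rewrite /zmul mu_1r alpha_id2 scale1r.
Qed.

Fact zmulC z w : in_center z -> zmul w z = zmul z w.
Proof.
move=> zC; apply: functional_extensionality_dep => X.
by rewrite /zmul (zC _ _ _ _ (esym (comp_idl (idm X)))) !alpha_id2 mulr1 scale1r.
Qed.

Fact muZl (X Y Z : C) (f : hom X Y) (g : hom Y Z) (h : hom X Z)
    (e : h = g ∘ f) c (x : A f) (y : A g) : mu e (c *: x) y = c *: mu e x y.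
Proof. exact: (lactZl (M := regular A)). Qed.
Fact muZr (X Y Z : C) (f : hom X Y) (g : hom Y Z) (h : hom X Z)
    (e : h = g ∘ f) c (x : A f) (y : A g) : mu e x (c *: y) = c *: mu e x y.
Proof. exact: (lactZr (M := regular A)). Qed.

Fact in_centerM z w : in_center z -> in_center w -> in_center (zmul z w).
Proof.
move=> zC wC X Y g el er a; have eX := esym (comp_idl (idm X)).
have eY := esym (comp_idl (idm Y)); rewrite (zmulE _ _ eX) (zmulE _ _ eY).
have /(congr1 (fun x => uinv (alpha g (idm Y) (idm Y)) *: x)) :=
  mu_assoc el el eY el a (z Y) (w Y).
rewrite scalerA [uinv _ * _]mulrC uvalV scale1r => <-.
rewrite (zC _ _ _ _ er) muZl (mu_assoc er el el er) alpha_id2 scale1r.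
rewrite (wC _ _ _ _ er) muZr (mu_assoc eX er er er) !scalerA.
congr (_ *: _); move: (alpha (idm X) (idm X) g) => p.
move: (alpha g (idm Y) (idm Y)) => q.
transitivity (uval p * uval q * uval p * (uval q * uinv q)); first by ring.
by rewrite uvalV mulr1.
Qed.

Section ZstarGroup.
Implicit Types x y : Zstar.

Lemma Zstar_inv_ex x : exists p : forall X : C, A (idm X),
  [/\ in_center (val x), in_center p & zmul (val x) p = one A].
Proof. by have /asboolP[xC [p [pC xp]]] := valP x; exists p. Qed.

Definition Zstar1 : Zstar.
Proof.
exists (one A); apply/asboolP; split; first exact: in_center_one.
by exists (one A); split; [exact: in_center_one | exact: zmul1].
Defined.

Definition ZstarM x y : Zstar.
Proof.
exists (zmul (val x) (val y)); apply/asboolP.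
have [p [xC pC xp]] := Zstar_inv_ex x; have [q [yC qC yq]] := Zstar_inv_ex y.
split; first exact: in_centerM.
exists (zmul q p); split; first exact: in_centerM.
by rewrite zmulA -(zmulA (val x)) yq zmul1r.
Defined.

Definition ZstarV x : Zstar.
Proof.
exists (projT1 (cid (Zstar_inv_ex x))); apply/asboolP.
case: cid => p [xC pC xp] /=; split=> //; exists (val x); split=> //.
by rewrite zmulC.
Defined.

Fact Zstar_mulA : associative ZstarM.
Proof. by move=> x y t; apply: val_inj; rewrite /= zmulA. Qed.
Fact Zstar_mul1 : left_id Zstar1 ZstarM.
Proof. by move=> x; apply: val_inj; rewrite /= zmul1. Qed.
Fact Zstar_1mul : right_id Zstar1 ZstarM.
Proof. by move=> x; apply: val_inj; rewrite /= zmul1r. Qed.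
Fact Zstar_Vmul : right_inverse Zstar1 ZstarV ZstarM.
Proof. by move=> x; apply: val_inj => /=; case: cid => p []. Qed.
Fact Zstar_mulV : left_inverse Zstar1 ZstarV ZstarM.
Proof.
move=> x; apply: val_inj => /=; case: cid => p [xC pC xp] /=.
by rewrite zmulC.
Qed.
HB.instance Definition _ := isGroup.Build Zstar
  Zstar_mulA Zstar_mul1 Zstar_1mul Zstar_mulV Zstar_Vmul.
End ZstarGroup.
End Center.

(* Main.v *)
(* Tensoring with M and tensoring with N are, up to the associator and the left
   unitor, mutually inverse endofunctors of K(A), so N ⊗ - is fully faithful and
   End(M) ≅ End(N ⊗ M) ≅ End(A). No coherence axiom is used: naturality of
   the isomorphism M ⊗ (N ⊗ X) ≅ X in X suffices. A is concentrated in degree 0,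
   where there are no homotopies, so that End(A) consists of the bimodule
   endomorphisms of A; such an endomorphism u is determined by the central family
   u(1_X). *)
From HB Require Import structures.
From mathcomp Require Import all_boot all_order all_algebra boolp ring zify.
Require Import Defs.

Set Implicit Arguments.
Unset Strict Implicit.
Unset Printing Implicit Defensive.
Import GRing.Theory.
Local Open Scope ring_scope.
Local Open Scope quotient_scope.

(** * Tensor products of bimodules *)

(** Two obstacles shape the proof. The constants [alpha] enter every structure map, so each map must
    be shown balanced and compatible with both actions up to the right scalars; the scalar
    identities that arise are instances of the pentagon, after cancellation of units. Moreover, a
    total tensor product is a family of components, whereas an element of its tensor product with a
    third bimodule has no components a priori. Boundedness turns the family into a finite biproduct,
    which every additive functor preserves, so that elements of a triple product are again
    determined by their components and can be prescribed through them. Accordingly, the associator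
    of complexes is defined by equations on components, and isomorphisms of complexes are obtained
    from injectivity and surjectivity in each degree, without a formula for the inverse. *)

Section TensMapLinear.
Variables (k : comPzRingType) (C : gradingCategory k) (A : galgebra C).

Lemma kunitZK (V : lmodType k) (c : kunit k) (x : V) : uinv c *: (uval c *: x) = x.
Proof. by rewrite scalerA mulrC uvalV scale1r. Qed.

Lemma tens_bimhom_eq (P Q R : bimod A) (u v : bimhom (tens_bimod P Q) R) :
  (forall (h : mor C) Y (f : hom (src h) Y) (g : hom Y (tgt h))
     (e : arr h = g ∘ f) (x : P f) (y : Q g),
     bfun u (f := h) (tpure e x y) = bfun v (f := h) (tpure e x y)) ->
  u = v.
Proof.
move=> uv; apply: bimhom_eq => h t.
by apply: (tens_linear_eq (bfun_linear u (f := h)) (bfun_linear v (f := h))).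
Qed.

Lemma tmapE (P P' Q Q' : bimod A) (u : bimhom P P') (v : bimhom Q Q')
    (h : mor C) Y (f : hom (src h) Y) (g : hom Y (tgt h))
    (e : arr h = g ∘ f) (x : P f) (y : Q g) :
  bfun (tmap u v) (f := h) (tpure e x y) = tpure e (bfun u x) (bfun v y).
Proof. exact: tmap_funE. Qed.

Lemma tmap_id (P Q : bimod A) : tmap (bimid P) (bimid Q) = bimid (tens_bimod P Q).
Proof. by apply: tens_bimhom_eq => h Y f g e x y; rewrite tmapE. Qed.

Lemma tmap_comp (P P' P2 Q Q' Q2 : bimod A) (u : bimhom P P') (u' : bimhom P' P2)
    (v : bimhom Q Q') (v' : bimhom Q' Q2) :
  tmap (bimcomp u' u) (bimcomp v' v) = bimcomp (tmap u' v') (tmap u v).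
Proof. by apply: bimhom_eq => f t; rewrite [RHS]tmap_fun_comp. Qed.

Lemma tmapDl (P P' Q Q' : bimod A) (u u' : bimhom P P') (v : bimhom Q Q') :
  tmap (u + u') v = tmap u v + tmap u' v.
Proof.
apply: tens_bimhom_eq => h Y f g e x y.
by rewrite bfunD !tmapE bfunD tpureDl.
Qed.

Lemma tmapDr (P P' Q Q' : bimod A) (u : bimhom P P') (v v' : bimhom Q Q') :
  tmap u (v + v') = tmap u v + tmap u v'.
Proof.
apply: tens_bimhom_eq => h Y f g e x y.
by rewrite bfunD !tmapE bfunD tpureDr.
Qed.

Lemma tmapZl (P P' Q Q' : bimod A) c (u : bimhom P P') (v : bimhom Q Q') :
  tmap (c *: u) v = c *: tmap u v.
Proof.
apply: tens_bimhom_eq => h Y f g e x y.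
by rewrite bfunZ !tmapE bfunZ tpureZl.
Qed.

Lemma tmapZr (P P' Q Q' : bimod A) c (u : bimhom P P') (v : bimhom Q Q') :
  tmap u (c *: v) = c *: tmap u v.
Proof.
apply: tens_bimhom_eq => h Y f g e x y.
by rewrite bfunZ !tmapE bfunZ tpureZr.
Qed.

Section Elementwise.
Variables (P P' Q Q' : bimod A) (h : mor C) (t : tens P Q h).

Lemma tmap_funDl (u u' : bimhom P P') (v : bimhom Q Q') :
  tmap_fun (u + u') v t = tmap_fun u v t + tmap_fun u' v t.
Proof. by rewrite -[LHS]/(bfun (tmap _ _) t) tmapDl. Qed.
Lemma tmap_funDr (u : bimhom P P') (v v' : bimhom Q Q') :
  tmap_fun u (v + v') t = tmap_fun u v t + tmap_fun u v' t.
Proof. by rewrite -[LHS]/(bfun (tmap _ _) t) tmapDr. Qed.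
Lemma tmap_funZl c (u : bimhom P P') (v : bimhom Q Q') :
  tmap_fun (c *: u) v t = c *: tmap_fun u v t.
Proof. by rewrite -[LHS]/(bfun (tmap _ _) t) tmapZl. Qed.
Lemma tmap_funZr c (u : bimhom P P') (v : bimhom Q Q') :
  tmap_fun u (c *: v) t = c *: tmap_fun u v t.
Proof. by rewrite -[LHS]/(bfun (tmap _ _) t) tmapZr. Qed.
End Elementwise.
End TensMapLinear.

Section BimhomLift.
Variables (k : comPzRingType) (C : gradingCategory k) (A : galgebra C).
Variables P Q R : bimod A.
Variable b : forall (h : mor C) Y (f : hom (src h) Y) (g : hom Y (tgt h)),
  arr h = g ∘ f -> P f -> Q g -> R h.
Hypothesis b_bal : forall h, balanced (b (h := h)).
Hypothesis bZ : forall h Y (f : hom (src h) Y) (g : hom Y (tgt h))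
  (e : arr h = g ∘ f) c x y, b e (c *: x) y = c *: b e x y.
Hypothesis b_lact : forall X Y Z W (f : hom X Y) (g : hom Y Z)
  (h : hom X Z) (e : h = g ∘ f) (u : hom Y W) (v : hom W Z)
  (ev : g = v ∘ u) (uf : hom X W) (e1 : uf = u ∘ f) (e2 : h = v ∘ uf)
  (a : A f) (x : P u) (y : Q v),
  b (h := h) e2 (lact e1 a x) y = uval (alpha f u v) *: lact e a (b (h := g) ev x y).
Hypothesis b_ract : forall X Y Z W (f : hom X Y) (g : hom Y Z)
  (h : hom X Z) (e : h = g ∘ f) (u : hom X W) (v : hom W Y)
  (ev : f = v ∘ u) (gv : hom W Z) (e1 : gv = g ∘ v) (e2 : h = gv ∘ u)
  (x : P u) (y : Q v) (a : A g),
  uval (alpha u v g) *: b (h := h) e2 x (ract e1 y a) = ract e (b (h := f) ev x y) a.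

Definition tens_bimhom_fun h : tens P Q h -> R h := tens_lift (@b h).
Fact tens_bimhom_linear h : linear (@tens_bimhom_fun h).
Proof. exact: tens_lift_linear (@b_bal h) (@bZ h). Qed.
HB.instance Definition _ h := GRing.isLinear.Build k _ _ *:%R
  (@tens_bimhom_fun h) (@tens_bimhom_linear h).

(** The universal property of the tensor product for bimodule maps. The action of [a] on a pure
    tensor costs [uinv (alpha f u v)] on the left and [uval (alpha u v g)] on the right; [b_lact]
    and [b_ract] carry the scalars that match these. *)
Lemma tens_bimhom_ex : {u : bimhom (tens_bimod P Q) R |
  forall (h : mor C) Y (f : hom (src h) Y) (g : hom Y (tgt h))
    (e : arr h = g ∘ f) (x : P f) (y : Q g),
  bfun u (f := h) (tpure e x y) = b e x y}.
Proof.
unshelve eexists.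
exists tens_bimhom_fun.
- by move=> h; exact: tens_bimhom_linear.
- move=> X Y Z f g h e a.
  suff E : @tens_bimhom_fun h \o tlactr_of e a =1 lactr_of e a \o @tens_bimhom_fun g.
    exact: E.
  apply: tens_linear_eq => [||W u v /= ev x y]; try exact: linearP.
  rewrite /tlactr_of /lactr_of /tens_bimhom_fun.
  have e2 : h = v ∘ (u ∘ f) by rewrite e ev compA.
  rewrite (tlactE e _ ev _ _ (erefl _) e2) !tens_lift_pure //.
  by rewrite bZ (b_lact e ev) kunitZK.
- move=> X Y Z f g h e t a; move: t.
  suff E : @tens_bimhom_fun h \o tractl_of e a =1 ractl_of e a \o @tens_bimhom_fun f.
    exact: E.
  apply: tens_linear_eq => [||W u v /= ev x y]; try exact: linearP.
  rewrite /tractl_of /ractl_of /tens_bimhom_fun.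
  have e2 : h = (g ∘ v) ∘ u by rewrite e ev compA.
  rewrite (tractE e _ ev _ _ (erefl _) e2) !tens_lift_pure //.
  by rewrite bZ (b_ract e ev).
by move=> h Y f g e x y; rewrite [LHS]tens_lift_pure.
Qed.
End BimhomLift.

Section AlphaIdentity.
Variables (k : comPzRingType) (C : gradingCategory k).
Variables (X Y Z : C) (f : hom X Y) (g : hom Y Z).

(** The pentagon at [(idm X, idm X, f, g)], in which [alpha (idm X) f g] occurs twice on one side
    and once on the other. It tells how the left unit constant changes under composition. *)
Lemma alpha_id_comp : uval (alpha (idm X) (idm X) (g ∘ f))
  = uval (alpha (idm X) (idm X) f) * uval (alpha (idm X) f g).
Proof.
have := alpha_pentagon (idm X) (idm X) f g; rewrite !comp_idr => E.
by apply: (kunitI (u := alpha (idm X) f g)); rewrite [LHS]mulrC -E [RHS]mulrC.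
Qed.

Lemma alpha_comp_id : uval (alpha (g ∘ f) (idm Z) (idm Z))
  = uval (alpha f g (idm Z)) * uval (alpha g (idm Z) (idm Z)).
Proof.
have := alpha_pentagon f g (idm Z) (idm Z); rewrite !comp_idl => E.
by apply: (kunitI (u := alpha f g (idm Z))); rewrite -E; ring.
Qed.
End AlphaIdentity.

(** * The isomorphism A ⊗_A B ≅ B *)

Section LeftUnitor.
Variables (k : comPzRingType) (C : gradingCategory k) (A : galgebra C).
Variable B : bimod A.

(** The match on [h] is there because [lact] lands in degree [Mor (arr h)], which is convertible to
    [h] only when [h] is a constructor. *)
Definition lunit_pure (h : mor C) : forall Y (f : hom (src h) Y)
    (g : hom Y (tgt h)), arr h = g ∘ f -> regular A f -> B g -> B h :=
  let: Mor X Z h := h in fun Y f g e a x => lact e a x.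

Fact lunit_bal h : balanced (@lunit_pure h).
Proof.
case: h => X Z h; split=> /= *.
- by rewrite lactDl.
- by rewrite lactDr.
- by rewrite lactZl lactZr.
- by rewrite lactZl; exact: lact_assoc.
Qed.

Lemma lunit_ex : {u : bimhom (tens_bimod (regular A) B) B |
  forall (X Y Z : C) (f : hom X Y) (g : hom Y Z) (h : hom X Z)
    (e : h = g ∘ f) (a : A f) (x : B g),
  bfun u (f := h) (tpure (M := regular A) (h := h) e a x) = lact e a x}.
Proof.
have [|||u uE] := tens_bimhom_ex lunit_bal.
- by case=> X Z h * /=; rewrite lactZl.
- by move=> X Y Z W f g h e u v ev uf e1 e2 a x y /=; exact: lact_assoc.
- by move=> X Y Z W f g h e u v ev gv e1 e2 x y a /=; rewrite (lract_assoc ev e e1 e2).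
by exists u => X Y Z f g h e a x; rewrite uE.
Qed.

Definition lunit := sval lunit_ex.
Definition lunitE := svalP lunit_ex.

Lemma lunit_surj h (x : B h) : exists t, bfun lunit t = x.
Proof.
have e1 : arr h = arr h ∘ idm (src h) by rewrite comp_idr.
case: h x e1 => X Y h /= x e1.
(* The scalar cancels the constant of the left unit law [lact_1]. *)
exists (tpure (M := regular A) (h := h) e1 (one A X) (uval (alpha (idm X) (idm X) h) *: x)).
rewrite [LHS]lunitE lactZr.
by have /= -> := lact_1 (b0 := B) e1 x; rewrite scalerA uvalV scale1r.
Qed.

(** Every element of A ⊗_A B has the form 1 ⊗ b, since a ⊗ x is a multiple of (1·a) ⊗ x and hence of
    1 ⊗ ax; keeping track of the scalars shows that b is determined by the image. *)
Lemma lunit_inj h (t : tens_bimod (regular A) B h) : bfun lunit t = 0 -> t = 0.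
Proof.
have e1 : arr h = arr h ∘ idm (src h) by rewrite comp_idr.
case: h t e1 => X Z h t /= e1.
have tE : t = tpure (M := regular A) (h := h) e1 (one A X)
    (uval (alpha (idm X) (idm X) h) *: bfun lunit t).
  elim/tens_indp: t => [|u v IHu IHv|Y f g /= e a x].
  - by rewrite linear0 scaler0 tpure0r.
  - by rewrite linearD scalerDr tpureDr -IHu -IHv.
  rewrite lunitE tpureZr.
  have ef : f = f ∘ idm X by rewrite comp_idr.
  have := tpure_bal (M := regular A) (h := h) ef e e e1 (one A _) a x.
  (* The balancing relation equates (1·a) ⊗ x with 1 ⊗ ax up to [alpha (idm X) f g]; multiplication
     by the unit constant of [f] turns 1·a back into [a]. *)
  move=> /(congr1 ( *:%R (uval (alpha (idm X) (idm X) f)))).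
  rewrite [ract _ _ _]mu_1l tpureZl scalerA uvalV scale1r => ->.
  by rewrite tpureZl scalerA -alpha_id_comp -e.
by move=> t0; rewrite tE t0 scaler0 tpure0r.
Qed.
End LeftUnitor.

Section TensAct.
Variables (k : comPzRingType) (C : gradingCategory k) (A : galgebra C).
Variables M N : bimod A.

(* tens_indp at a degree h : hom X Z, without the projections src h and tgt h
   that block rewriting. *)
Lemma tens_hom_indp X Z (h : hom X Z) (K : tens M N h -> Prop) :
  K 0 -> (forall u v, K u -> K v -> K (u + v)) ->
  (forall Y (f : hom X Y) (g : hom Y Z) (e : h = g ∘ f) x y,
     K (tpure (h := h) e x y)) ->
  forall u, K u.
Proof. exact: (@tens_indp _ _ _ M N h K). Qed.

Lemma lact_tpure X Y Z (f : hom X Y) (g : hom Y Z) (h : hom X Z)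
    (e : h = g ∘ f) (a : A f) W (u : hom Y W) (v : hom W Z)
    (ev : g = v ∘ u) (x : M u) (y : N v) (uf : hom X W) (e1 : uf = u ∘ f)
    (e2 : h = v ∘ uf) :
  lact (b0 := tens_bimod M N) e a (tpure (h := g) ev x y)
  = uinv (alpha f u v) *: tpure (h := h) e2 (lact e1 a x) y.
Proof. by rewrite -tpureZl; exact: tlactE. Qed.

Lemma ract_tpure X Y Z (f : hom X Y) (g : hom Y Z) (h : hom X Z)
    (e : h = g ∘ f) (b : A g) W (u : hom X W) (v : hom W Y)
    (ev : f = v ∘ u) (x : M u) (y : N v) (gv : hom W Z) (e1 : gv = g ∘ v)
    (e2 : h = gv ∘ u) :
  ract (b0 := tens_bimod M N) e (tpure (h := f) ev x y) b
  = uval (alpha u v g) *: tpure (h := h) e2 x (ract e1 y b).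
Proof. by rewrite -tpureZl; exact: tractE. Qed.
End TensAct.

(** * The associator of bimodules *)

Section Associator.
Variables (k : comPzRingType) (C : gradingCategory k) (A : galgebra C).
Variables P N Q : bimod A.
Local Notation PN := (tens_bimod P N).
Local Notation NQ := (tens_bimod N Q).

Section Right.
Variables (h : mor C) (Y : C) (u : hom (src h) Y) (v : hom Y (tgt h)).
Variables (e : arr h = v ∘ u) (z : Q v).

Fact assoc_eq W (f : hom (src h) W) (g : hom W Y) (e1 : u = g ∘ f) :
  arr h = (v ∘ g) ∘ f.
Proof. by rewrite e e1 compA. Qed.

(** The associator is lifted twice, because the first factor of a pure tensor in (P ⊗ N) ⊗ Q is
    itself a sum of tensors. Here the right factor [z] is fixed and x ⊗ y varies; with [assoc_fun]
    also [z] varies. *)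
Definition assoc_pure W (f : hom (src h) W) (g : hom W Y) (e1 : u = g ∘ f)
    (x : P f) (y : N g) : tens P NQ h :=
  tpure (N := NQ) (assoc_eq e1) (uval (alpha f g v) *: x)
    (tpure (h := v ∘ g) (erefl (v ∘ g)) y z : NQ (v ∘ g)).

(** Moving [a] across produces the five scalars of the pentagon at [(f, g, l, v)]: [alpha gf l v],
    [alpha f g (v ∘ l)] and the inverse of [alpha g l v] against [alpha f lg v] and
    [alpha f g l]. *)
Fact assoc_bal : balanced (h := u) assoc_pure.
Proof.
split; rewrite /assoc_pure.
- by move=> *; rewrite scalerDr tpureDl.
- by move=> *; rewrite tpureDl tpureDr.
- by move=> *; rewrite scalerA mulrC -scalerA tpureZlr -[X in tpure _ _ X]tpureZl.
move=> /= W V f g l gf lg e1 e2 e3 e4 m a n.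
have e5 : v ∘ lg = v ∘ l ∘ g by rewrite e3 compA.
rewrite [LHS]tpureZl (tpure_bal (N := NQ) (h := h) e1 (assoc_eq e2) e5 (assoc_eq e4)).
rewrite (lact_tpure e5 a (erefl (v ∘ l)) n z e3 (erefl (v ∘ lg))).
rewrite !(tpureZl (M:=P) (N:=NQ)) tpureZr !scalerA; congr (_ *: _).
have := alpha_pentagon f g l v; rewrite -e1 -e3.
move: (alpha f g (v ∘ l)) (alpha g l v) (alpha gf l v) => p q r.
move: (uval (alpha f g l)) (uval (alpha f lg v)) => s t E.
rewrite [_ * uval p]mulrC -E -!mulrA uvalV mulr1 mulrC; ring.
Qed.
End Right.

Definition assoc_fun h Y (u : hom (src h) Y) (v : hom Y (tgt h))
    (e : arr h = v ∘ u) (t : PN u) (z : Q v) : tens_bimod P NQ h :=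
  tens_lift (h := u) (assoc_pure e z) t.

Lemma assoc_funE h Y (u : hom (src h) Y) (v : hom Y (tgt h))
    (e : arr h = v ∘ u) W (f : hom (src h) W) (g : hom W Y)
    (e1 : u = g ∘ f) (x : P f) (y : N g) (z : Q v) gv (e2 : arr h = gv ∘ f)
    (e3 : gv = v ∘ g) :
  assoc_fun e (tpure (h := u) e1 x y) z
  = uval (alpha f g v) *: tpure (N := NQ) e2 x (tpure (h := gv) e3 y z).
Proof.
rewrite /assoc_fun tens_lift_pure; last exact: assoc_bal.
by subst gv; rewrite /assoc_pure tpureZl (Prop_irrelevance (assoc_eq e e1) e2).
Qed.

Lemma assoc_funDl h Y (u : hom (src h) Y) (v : hom Y (tgt h))
    (e : arr h = v ∘ u) (t t' : PN u) (z : Q v) :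
  assoc_fun e (t + t') z = assoc_fun e t z + assoc_fun e t' z.
Proof. exact/tens_liftD/assoc_bal. Qed.

Lemma assoc_fun0l h Y (u : hom (src h) Y) (v : hom Y (tgt h))
    (e : arr h = v ∘ u) (z : Q v) : assoc_fun e 0 z = 0.
Proof. exact/tens_lift0/assoc_bal. Qed.

Lemma assoc_funZl h Y (u : hom (src h) Y) (v : hom Y (tgt h))
    (e : arr h = v ∘ u) c (t : PN u) (z : Q v) :
  assoc_fun e (c *: t) z = c *: assoc_fun e t z.
Proof.
elim/tens_hom_indp: t => [|s t IHs IHt|W f g e1 x y].
- by rewrite scaler0 assoc_fun0l scaler0.
- by rewrite scalerDr !assoc_funDl IHs IHt scalerDr.
have e2 : arr h = v ∘ g ∘ f by rewrite e e1 compA.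
rewrite -tpureZl !(assoc_funE _ _ _ _ _ e2 (erefl _)) (tpureZl (N := NQ)).
by rewrite !scalerA mulrC.
Qed.

Lemma assoc_fun_bal h : balanced (@assoc_fun h).
Proof.
split.
- exact: assoc_funDl.
- move=> Y u v e t z z'.
  elim/tens_hom_indp: t => [|s t IHs IHt|W f g e1 x y].
  + by rewrite !assoc_fun0l addr0.
  + by rewrite !assoc_funDl IHs IHt addrACA.
  have e2 : arr h = v ∘ g ∘ f by rewrite e e1 compA.
  rewrite !(assoc_funE _ _ _ _ _ e2 (erefl _)) (tpureDr (M := N) (N := Q)).
  by rewrite (tpureDr (N := NQ)) scalerDr.
- move=> Y u v e c t z; rewrite assoc_funZl.
  elim/tens_hom_indp: t => [|s t IHs IHt|W f g e1 x y].
  + by rewrite !assoc_fun0l scaler0.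
  + by rewrite !assoc_funDl scalerDr IHs IHt.
  have e2 : arr h = v ∘ g ∘ f by rewrite e e1 compA.
  rewrite !(assoc_funE _ _ _ _ _ e2 (erefl _)).
  by rewrite (tpureZr (M := N) (N := Q)) (tpureZr (N := NQ)) !scalerA mulrC.
move=> Y Z u a l ua al e1 e2 e3 e4 t b z.
elim/tens_hom_indp: t => [|s t IHs IHt|W f g e5 x y].
- by rewrite ract0l scaler0 !assoc_fun0l.
- by rewrite ractDl scalerDr !assoc_funDl IHs IHt.
have e6 : ua = (a ∘ g) ∘ f by rewrite e1 e5 compA.
have e7 : arr h = (al ∘ g) ∘ f by rewrite e4 e5 compA.
have e8 : al ∘ g = l ∘ (a ∘ g) by rewrite e3 compA.
rewrite (ract_tpure e1 b e5 x y (erefl _) e6).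
rewrite !assoc_funZl (assoc_funE _ _ _ _ _ e7 e8) (assoc_funE _ _ _ _ _ e7 (erefl _)).
have -> := tpure_bal (h := al ∘ g) (erefl _) e8 e3 (erefl _) y b z.
rewrite !(tpureZl (M := N) (N := Q)) !(tpureZr (N := NQ)) !scalerA; congr (_ *: _).
have := alpha_pentagon f g a l; rewrite -e3 -e5 => E.
by rewrite [RHS]mulrC -[RHS]E; ring.
Qed.

(** The intermediate composites are quantified together with their equations, so that any bracketing
    of the same arrow can be supplied. Compatibility with each of the two actions is again a
    pentagon. *)
Lemma bassoc_ex : {w : bimhom (tens_bimod PN Q) (tens_bimod P NQ) |
  forall (h : mor C) Y (u : hom (src h) Y) (v : hom Y (tgt h))
    (e : arr h = v ∘ u) W (f : hom (src h) W) (g : hom W Y)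
    (e1 : u = g ∘ f) (x : P f) (y : N g) (z : Q v) gv (e2 : arr h = gv ∘ f)
    (e3 : gv = v ∘ g),
  bfun w (f := h) (tpure (M := PN) e (tpure (h := u) e1 x y) z)
  = uval (alpha f g v) *: tpure (N := NQ) e2 x (tpure (h := gv) e3 y z)}.
Proof.
have [|||w wE] := tens_bimhom_ex assoc_fun_bal.
- exact: assoc_funZl.
- move=> X Y Z W f g h e u v ev uf e1 e2 a t z.
  elim/tens_hom_indp: t => [|s t IHs IHt|V p q e5 x y].
  + by rewrite lact0r !assoc_fun0l lact0r scaler0.
  + by rewrite lactDr !assoc_funDl IHs IHt lactDr scalerDr.
  have e6 : uf = q ∘ (p ∘ f) by rewrite e1 e5 compA.
  have e7 : h = v ∘ q ∘ (p ∘ f) by rewrite e2 e6 compA.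
  have e8 : g = v ∘ q ∘ p by rewrite ev e5 compA.
  rewrite (lact_tpure e1 a e5 x y (erefl _) e6).
  rewrite ?assoc_funZl (assoc_funE (h := h) _ _ _ _ _ e7 (erefl _)).
  rewrite (assoc_funE (h := g) _ _ _ _ _ e8 (erefl _)).
  rewrite lactZr.
  rewrite (lact_tpure (N := NQ) e a e8 x (tpure (h := v ∘ q) erefl y z) (erefl _) e7).
  rewrite ?(tpureZl (N := NQ)) !scalerA; congr (_ *: _).
  have := alpha_pentagon f p q v; rewrite -e5.
  move: (alpha f p q) (alpha f p (v ∘ q)) => r s.
  move: (uval (alpha f u v)) (uval (alpha p q v)) (uval (alpha (p ∘ f) q v)).
  move=> a1 a2 a3 E.
  apply: (kunitI (u := r)); apply: (kunitI (u := s)).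
  transitivity (uval s * a3 * (uval r * uinv r)); first by ring.
  rewrite -E uvalV; transitivity (uval r * a1 * a2 * (uval s * uinv s)); last by ring.
  by rewrite uvalV.
- move=> X Y Z W f g h e u v ev gv e1 e2 t z b.
  elim/tens_hom_indp: t => [|s t IHs IHt|V p q e5 x y].
  + by rewrite !assoc_fun0l ract0l scaler0.
  + by rewrite !assoc_funDl scalerDr IHs IHt ractDl.
  have e7 : h = gv ∘ q ∘ p by rewrite e2 e5 compA.
  have e8 : f = v ∘ q ∘ p by rewrite ev e5 compA.
  have e9 : gv ∘ q = g ∘ (v ∘ q) by rewrite e1 compA.
  rewrite ?assoc_funZl (assoc_funE (h := h) _ _ _ _ _ e7 (erefl _)).
  rewrite (assoc_funE (h := f) _ _ _ _ _ e8 (erefl _)).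
  rewrite ractZl.
  rewrite (ract_tpure (N := NQ) e b e8 x (tpure (h := v ∘ q) erefl y z) e9 e7).
  rewrite (ract_tpure e9 b (erefl _) y z e1 (erefl _)).
  rewrite (tpureZr (N := NQ)) !scalerA; congr (_ *: _).
  have := alpha_pentagon p q v g; rewrite -e5 -e1 => E.
  by rewrite [LHS]mulrC -E; ring.
exists w => h Y u v e W f g e1 x y z gv e2 e3.
by rewrite wE (assoc_funE _ _ _ _ _ e2 e3).
Qed.

Definition bassoc := sval bassoc_ex.
Definition bassocE := svalP bassoc_ex.

Section Left.
Variables (h : mor C) (W : C) (f : hom (src h) W) (v : hom W (tgt h)).
Variables (e : arr h = v ∘ f) (x : P f).

Fact assocV_eq Y (g : hom W Y) (l : hom Y (tgt h)) (e1 : v = l ∘ g) :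
  arr h = l ∘ (g ∘ f).
Proof. by rewrite e e1 compA. Qed.

(** The inverse associator, with the inverse scalar. It serves to show that [bassoc] is bijective in
    each degree, for which an additive map in each degree is enough. *)
Definition assocV_pure Y (g : hom W Y) (l : hom Y (tgt h)) (e1 : v = l ∘ g)
    (y : N g) (z : Q l) : tens PN Q h :=
  uinv (alpha f g l) *:
    tpure (M := PN) (assocV_eq e1) (tpure (h := g ∘ f) erefl x y) z.

Fact assocV_bal : balanced (h := v) assocV_pure.
Proof.
split; rewrite /assocV_pure.
- by move=> /= *; rewrite (tpureDr (M := P)) (tpureDl (M := PN)) scalerDr.
- by move=> /= *; rewrite (tpureDr (M := PN)) scalerDr.
- move=> /= *; rewrite (tpureZr (M := P)) (tpureZl (M := PN)).
  by rewrite (tpureZr (M := PN)).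
move=> /= Y Z g b l bg lb e1 e2 e3 e4 m a n.
have e5 : bg ∘ f = b ∘ (g ∘ f) by rewrite e1 compA.
have := tpure_bal (M := PN) (h := h) e5 (assocV_eq e2) e3 (assocV_eq e4)
  (tpure (M := P) (N := N) (h := g ∘ f) (erefl (g ∘ f)) x m) a n.
rewrite (ract_tpure e5 a (erefl (g ∘ f)) x m e1 (erefl (bg ∘ f))) !(tpureZl (M := PN)).
rewrite (tpureZr (M := P)) (tpureZl (M := PN)).
move=> /(congr1 ( *:%R (uinv (alpha f g b)))); rewrite kunitZK => ->.
rewrite !scalerA; congr (_ *: _).
have := alpha_pentagon f g b l; rewrite -e1 -e3.
move: (alpha f g b) (alpha f bg l) (alpha f g lb) => p q r.
move: (uval (alpha (g ∘ f) b l)) (uval (alpha g b l)) => s t E.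
apply: (kunitI (u := p)); apply: (kunitI (u := q)); apply: (kunitI (u := r)).
transitivity (uval r * s * (uval q * uinv q) * (uval p * uinv p)); first by ring.
by rewrite !uvalV !mulr1 -E -[LHS]mulr1 -(uvalV r); ring.
Qed.
End Left.

Definition assocV_fun h W (f : hom (src h) W) (v : hom W (tgt h))
    (e : arr h = v ∘ f) (x : P f) (t : NQ v) : tens_bimod PN Q h :=
  tens_lift (h := v) (assocV_pure e x) t.

Lemma assocV_funE h W (f : hom (src h) W) (v : hom W (tgt h))
    (e : arr h = v ∘ f) Y (g : hom W Y) (l : hom Y (tgt h))
    (e1 : v = l ∘ g) (x : P f) (y : N g) (z : Q l) gf (e2 : arr h = l ∘ gf)
    (e3 : gf = g ∘ f) :
  assocV_fun e x (tpure (h := v) e1 y z)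
  = uinv (alpha f g l) *: tpure (M := PN) e2 (tpure (h := gf) e3 x y) z.
Proof.
rewrite /assocV_fun tens_lift_pure; last exact: assocV_bal.
by subst gf; rewrite /assocV_pure (Prop_irrelevance (assocV_eq e e1) e2).
Qed.

Lemma assocV_funDr h W (f : hom (src h) W) (v : hom W (tgt h))
    (e : arr h = v ∘ f) (x : P f) (t t' : NQ v) :
  assocV_fun e x (t + t') = assocV_fun e x t + assocV_fun e x t'.
Proof. exact/tens_liftD/assocV_bal. Qed.

Lemma assocV_fun0r h W (f : hom (src h) W) (v : hom W (tgt h))
    (e : arr h = v ∘ f) (x : P f) : assocV_fun e x 0 = 0.
Proof. exact/tens_lift0/assocV_bal. Qed.

Lemma assocV_funZr h W (f : hom (src h) W) (v : hom W (tgt h))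
    (e : arr h = v ∘ f) c (x : P f) (t : NQ v) :
  assocV_fun e x (c *: t) = c *: assocV_fun e x t.
Proof.
elim/tens_hom_indp: t => [|s t IHs IHt|Y g l e1 y z].
- by rewrite scaler0 assocV_fun0r scaler0.
- by rewrite scalerDr !assocV_funDr IHs IHt scalerDr.
have e2 : arr h = l ∘ (g ∘ f) by rewrite e e1 compA.
rewrite -tpureZr !(assocV_funE _ _ _ _ _ e2 (erefl _)) (tpureZr (M := PN)).
by rewrite !scalerA mulrC.
Qed.

Lemma assocV_fun_bal h : balanced (@assocV_fun h).
Proof.
split.
- move=> W f v e x x' t.
  elim/tens_hom_indp: t => [|s t IHs IHt|Y g l e1 y z].
  + by rewrite !assocV_fun0r addr0.
  + by rewrite !assocV_funDr IHs IHt addrACA.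
  have e2 : arr h = l ∘ (g ∘ f) by rewrite e e1 compA.
  rewrite !(assocV_funE _ _ _ _ _ e2 (erefl _)).
  by rewrite (tpureDl (M := P) (N := N)) (tpureDl (M := PN)) scalerDr.
- by move=> W f v e x t t'; exact: assocV_funDr.
- move=> W f v e c x t; rewrite assocV_funZr.
  elim/tens_hom_indp: t => [|s t IHs IHt|Y g l e1 y z].
  + by rewrite !assocV_fun0r scaler0.
  + by rewrite !assocV_funDr scalerDr IHs IHt.
  have e2 : arr h = l ∘ (g ∘ f) by rewrite e e1 compA.
  rewrite !(assocV_funE _ _ _ _ _ e2 (erefl _)).
  by rewrite (tpureZl (M := P) (N := N)) (tpureZl (M := PN)) !scalerA mulrC.
move=> W Z f a v af va e1 e2 e3 e4 x b t.
elim/tens_hom_indp: t => [|s t IHs IHt|Y g l e5 y z].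
- by rewrite lact0r !assocV_fun0r.
- by rewrite lactDr !assocV_funDr IHs IHt.
have e6 : va = l ∘ (g ∘ a) by rewrite e3 e5 compA.
have e7 : arr h = l ∘ (g ∘ af) by rewrite e2 e5 compA.
have e8 : g ∘ af = (g ∘ a) ∘ f by rewrite e1 compA.
rewrite (lact_tpure e3 b e5 y z (erefl _) e6) assocV_funZr.
rewrite (assocV_funE _ _ _ _ _ e7 (erefl _)) (assocV_funE _ _ _ _ _ e7 e8).
have -> := tpure_bal (h := g ∘ af) e1 (erefl _) (erefl _) e8 x b y.
rewrite !(tpureZl (M := P) (N := N)) !(tpureZl (M := PN)) !scalerA; congr (_ *: _).
have := alpha_pentagon f a g l; rewrite -e1 -e5.
move: (alpha f a v) (alpha af g l) (alpha a g l) (alpha f (g ∘ a) l) => p q r s.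
move: (uval (alpha f a g)) => t E.
apply: (kunitI (u := q)); apply: (kunitI (u := r)); apply: (kunitI (u := s)).
transitivity (t * uval s * uval r * (uval q * uinv q)); first by ring.
rewrite E; transitivity (uval p * uval q * ((uval q * uinv q))); first by ring.
transitivity (uval p * uval q * (uval r * uinv r) * (uval s * uinv s)); last by ring.
by rewrite !uvalV !mulr1.
Qed.

Lemma bassocK h (t : tens_bimod PN Q h) : tens_lift (@assocV_fun h) (bfun bassoc t) = t.
Proof.
have aD := tens_liftD (@assocV_fun_bal h).
elim/tens_indp: t => [|s t IHs IHt|Y u v e t z].
- by rewrite linear0 tens_lift0 //; exact: assocV_fun_bal.
- by rewrite linearD /= aD IHs IHt.
elim/tens_hom_indp: t => [|s t IHs IHt|W f g e1 x y].
- by rewrite tpure0l linear0 tens_lift0 //; exact: assocV_fun_bal.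
- by rewrite (tpureDl (M := PN)) linearD /= aD IHs IHt.
have e2 : arr h = v ∘ g ∘ f by rewrite e e1 compA.
rewrite (bassocE e e1 x y z e2 (erefl _)) -(tpureZl (N := NQ)).
rewrite tens_lift_pure; last exact: assocV_fun_bal.
rewrite (assocV_funE _ _ _ _ _ e e1).
by rewrite (tpureZl (M := P) (N := N)) (tpureZl (M := PN)) kunitZK.
Qed.

Lemma bassocVK h (t : tens_bimod P NQ h) : bfun bassoc (tens_lift (@assocV_fun h) t) = t.
Proof.
have aD := tens_liftD (@assocV_fun_bal h).
elim/tens_indp: t => [|s t IHs IHt|W f v e x t].
- by rewrite tens_lift0 ?linear0 //; exact: assocV_fun_bal.
- by rewrite aD linearD /= IHs IHt.
elim/tens_hom_indp: t => [|s t IHs IHt|Y g l e1 y z].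
- by rewrite tpure0r tens_lift0 ?linear0 //; exact: assocV_fun_bal.
- by rewrite (tpureDr (N := NQ)) aD linearD /= IHs IHt.
have e2 : arr h = l ∘ (g ∘ f) by rewrite e e1 compA.
rewrite tens_lift_pure; last exact: assocV_fun_bal.
rewrite (assocV_funE _ _ _ _ _ e2 (erefl _)) linearZ /=.
by rewrite (bassocE e2 (erefl _) x y z e e1) kunitZK.
Qed.
End Associator.

Lemma bassoc_nat (k : comPzRingType) (C : gradingCategory k) (A : galgebra C)
    (P P' N N' Q Q' : bimod A) (u : bimhom P P') (v : bimhom N N')
    (w : bimhom Q Q') :
  bimcomp (bassoc P' N' Q') (tmap (tmap u v) w)
  = bimcomp (tmap u (tmap v w)) (bassoc P N Q).
Proof.
apply: tens_bimhom_eq => h Y f g e t z /=.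
elim/tens_hom_indp: t => [|s t IHs IHt|W p q e1 x y].
- by rewrite tpure0l !linear0.
- by rewrite (tpureDl (M := tens_bimod P N)) !linearD /= IHs IHt.
have e2 : arr h = g ∘ q ∘ p by rewrite e e1 compA.
rewrite (bassocE e e1 x y z e2 (erefl _)) tmap_funE.
rewrite (tmapE u v (h := f) e1 x y) (bassocE e e1 _ _ _ e2 (erefl _)).
rewrite linearZ /= tmap_funE; congr (_ *: tpure _ _ _).
by rewrite [RHS](tmapE v w (h := g ∘ q) (erefl _) y z).
Qed.

Lemma bfunB (k : comPzRingType) (C : gradingCategory k) (A : galgebra C)
    (P Q : bimod A) (u : bimhom P Q) f (x y : P f) :
  bfun u (x - y) = bfun u x - bfun u y.
Proof. exact: linearB. Qed.

Lemma bfun_add (k : comPzRingType) (C : gradingCategory k) (A : galgebra C)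
    (P Q : bimod A) (u : bimhom P Q) f (x y : P f) :
  bfun u (x + y) = bfun u x + bfun u y.
Proof. exact: linearD. Qed.

Lemma bfun_scale (k : comPzRingType) (C : gradingCategory k) (A : galgebra C)
    (P Q : bimod A) (u : bimhom P Q) f c (x : P f) :
  bfun u (c *: x) = c *: bfun u x.
Proof. exact: linearZ. Qed.

(** * Bimodule maps prescribed by components, and inverses of chain maps *)

Section BimhomSum.
Variables (k : comPzRingType) (C : gradingCategory k) (A : galgebra C).

Lemma bfun_sum (P Q : bimod A) I (r : seq I) (u : I -> bimhom P Q) f (x : P f) :
  bfun (\sum_(i <- r) u i) x = \sum_(i <- r) bfun (u i) x.
Proof.
elim: r => [|i r IH]; first by rewrite !big_nil.
by rewrite !big_cons bfunD IH.
Qed.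

Variables (U V : bimod A) (I : Type) (W : I -> bimod A).
Variables (a : forall i, bimhom U (W i)) (b : forall i, bimhom V (W i)).

(** For each [x] the equations have exactly one solution [y], and uniqueness forces the chosen
    solutions to be linear and compatible with both actions. With one index this yields inverses,
    with triples of indices the associator of complexes. *)
Lemma bimhom_solve :
  (forall f (x : U f), exists y, forall i, bfun (b i) y = bfun (a i) x) ->
  (forall f (y : V f), (forall i, bfun (b i) y = 0) -> y = 0) ->
  {w : bimhom U V | forall i f (x : U f), bfun (b i) (bfun w x) = bfun (a i) x}.
Proof.
move=> ex uq.
have eqV f (y y' : V f) : (forall i, bfun (b i) y = bfun (b i) y') -> y = y'.
  move=> yy; apply/eqP; rewrite -subr_eq0; apply/eqP/uq => i.
  by rewrite linearB /= yy subrr.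
pose w f x := projT1 (cid (@ex f x)).
have wE f x i : bfun (b i) (w f x) = bfun (a i) x.
  by rewrite /w; case: cid.
unshelve eexists; first exists w.
- by move=> f c x y; apply: eqV => i; rewrite linearP /= !wE linearP.
- by move=> X Y Z f g h e x y; apply: eqV => i; rewrite bfun_lact !wE bfun_lact.
- by move=> X Y Z f g h e x y; apply: eqV => i; rewrite bfun_ract !wE bfun_ract.
by move=> i f x; exact: wE.
Qed.
End BimhomSum.

Section ChainMaps.
Variables (k : comPzRingType) (C : gradingCategory k) (A : galgebra C).

(** The inverse in each degree comes from [bimhom_solve]; it commutes with the differentials because
    [u] does and is injective. *)
Lemma chmap_inv (M N : complex A) (u : chmap M N) :
  (forall i f (x : M i f), bfun (cmap u i) x = 0 -> x = 0) ->
  (forall i f (y : N i f), exists x, bfun (cmap u i) x = y) ->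
  exists v : chmap N M, chcomp v u = chid M /\ chcomp u v = chid N.
Proof.
move=> uI uS.
have uII i f (x x' : M i f) : bfun (cmap u i) x = bfun (cmap u i) x' -> x = x'.
  move=> xx; apply/eqP; rewrite -subr_eq0; apply/eqP/uI.
  by rewrite linearB /= xx subrr.
pose w i := @bimhom_solve _ _ _ (N i) (M i) unit (fun=> N i)
  (fun=> bimid _) (fun=> cmap u i)
  (fun f y => let: ex_intro x xE := uS i f y in ex_intro _ x (fun=> xE))
  (fun f x x0 => uI i f x (x0 tt)).
have wE i f y : bfun (cmap u i) (bfun (sval (w i)) y) = y :> N i f.
  exact: (svalP (w i) tt).
have wd (i j : int) (e : j = i + 1) f (y : N i f) :
    bfun (sval (w j)) (bfun (cd N e) y) = bfun (cd M e) (bfun (sval (w i)) y).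
  by apply: uII; rewrite cmap_cd !wE.
exists (Chmap wd); split; apply: chmap_eq => i f x /=; last exact: wE.
by apply: uII; rewrite wE.
Qed.
End ChainMaps.

(** * Total tensor products of complexes *)

Definition zrange (b : nat) : seq int := [seq Posz m - Posz b | m <- iota 0 b.*2.+1].

Lemma mem_zrange b (i : int) : (`|i| <= b)%N -> i \in zrange b.
Proof.
move=> ib; apply/mapP; exists (absz (i + Posz b)); last by lia.
by rewrite mem_iota; lia.
Qed.

Lemma zrange_uniq b : uniq (zrange b).
Proof. by rewrite map_inj_uniq ?iota_uniq // => m n /addIr[]. Qed.

(** * Total complexes as finite biproducts *)

Section TotalBiproduct.
Variables (k : comPzRingType) (C : gradingCategory k) (A : galgebra C).
Variables M N : complex A.
Local Notation T i j := (tens_bimod (M i) (N j)).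

Definition tproj (n i j : int) : bimhom (tot_bimod M N n) (T i j).
Proof. by exists (fun f t => tval t i j). Defined.

Lemma tproj_eq n f (t u : tot_bimod M N n f) :
  (forall i j, i + j = n -> bfun (tproj n i j) t = bfun (tproj n i j) u) -> t = u.
Proof.
move=> tu; apply: totc_eq => i j.
by have [/tu//|/eqP ij] := eqVneq (i + j) n; rewrite !tsupp.
Qed.

Lemma tproj0 n i j : i + j <> n -> tproj n i j = 0.
Proof. by move=> ij; apply: bimhom_eq => f t; exact: tsupp. Qed.

(** A Kronecker delta with values in a family of modules: the decided equalities are matched on, so
    that [x] can be transported to the fibre over [(i', j')]. *)
Definition tdelta (i j i' j' : int) f (x : T i j f) : T i' j' f :=
  match i =P i', j =P j' with
  | ReflectT e, ReflectT e' =>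
      match e in _ = p, e' in _ = q return T p q f with erefl, erefl => x end
  | _, _ => 0
  end.

Lemma tdelta_id i j f (x : T i j f) : tdelta i j x = x.
Proof.
rewrite /tdelta; case: eqP => // e; case: eqP => // e'.
by rewrite (Prop_irrelevance e erefl) (Prop_irrelevance e' erefl).
Qed.

Lemma tdelta0 i j i' j' f (x : T i j f) : i <> i' -> tdelta i' j' x = 0.
Proof. by rewrite /tdelta; case: eqP. Qed.

Lemma tdelta_supp n i j (e : i + j = n) f (x : T i j f) i' j' :
  i' + j' <> n -> tdelta i' j' x = 0.
Proof.
rewrite /tdelta; case: eqP => // ei; case: eqP => // ej.
by case: _ / ei => //; case: _ / ej.
Qed.

Definition tinj (n i j : int) (e : i + j = n) : bimhom (T i j) (tot_bimod M N n).
Proof.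
exists (fun f x => Totc (@tdelta_supp n i j e f x)).
- move=> f c x y; apply: totc_eq => i' j' /=; rewrite /tdelta.
  case: eqP => [ei|_]; last by rewrite scaler0 addr0.
  case: eqP => [ej|_]; last by rewrite scaler0 addr0.
  by case: _ / ei; case: _ / ej.
- move=> X Y Z f g h e' a x; apply: totc_eq => i' j'.
  rewrite -[RHS]/(lact (b0 := T i' j') e' a (tdelta i' j' x)).
  rewrite -[LHS]/(tdelta i' j' _) /tdelta.
  case: eqP => [ei|_]; last by rewrite lact0r.
  case: eqP => [ej|_]; last by rewrite lact0r.
  by case: _ / ei; case: _ / ej.
- move=> X Y Z f g h e' x a; apply: totc_eq => i' j'.
  rewrite -[RHS]/(ract (b0 := T i' j') e' (tdelta i' j' x) a).
  rewrite -[LHS]/(tdelta i' j' _) /tdelta.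
  case: eqP => [ei|_]; last by rewrite ract0l.
  case: eqP => [ej|_]; last by rewrite ract0l.
  by case: _ / ei; case: _ / ej.
Defined.

Lemma tproj_inj n i j (e : i + j = n) : bimcomp (tproj n i j) (tinj e) = bimid _.
Proof. by apply: bimhom_eq => f x; exact: tdelta_id. Qed.

Lemma tproj_inj0 n i j (e : i + j = n) i' j' :
  i <> i' -> bimcomp (tproj n i' j') (tinj e) = 0.
Proof. by move=> ii'; apply: bimhom_eq => f x; exact: tdelta0. Qed.

Section AdditiveFunctor.
Variable F : bimod A -> bimod A.
Variable Fm : forall B B' : bimod A, bimhom B B' -> bimhom (F B) (F B').
Hypothesis Fid : forall B, Fm (bimid B) = bimid (F B).
Hypothesis Fcomp : forall B B' B2 (v : bimhom B' B2) (u : bimhom B B'),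
  Fm (bimcomp v u) = bimcomp (Fm v) (Fm u).
Hypothesis FD : forall B B' (u v : bimhom B B'), Fm (u + v) = Fm u + Fm v.

Lemma Fm0 B B' : Fm (0 : bimhom B B') = 0.
Proof. by apply: (@addrI _ (Fm 0)); rewrite -FD !addr0. Qed.

Lemma Fm_sum B B' I (r : seq I) (u : I -> bimhom B B') :
  Fm (\sum_(i <- r) u i) = \sum_(i <- r) Fm (u i).
Proof. exact: (big_morph _ (@FD B B') (Fm0 B B')). Qed.

Let bd := projT1 (cid (cbounded M)).

(** Vanishing is expressed through the identity map because this is the form that an additive
    functor transports. *)
Lemma bdP i : (bd < `|i|)%N -> forall j, bimid (T i j) = 0.
Proof.
rewrite /bd; case: cid => b bP /= /bP Mi j; apply: tens_bimhom_eq => h Y f g e x y.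
by rewrite (Mi _ x) tpure0l linear0.
Qed.

Lemma Fzero i j f (x : F (T i j) f) : (bd < `|i|)%N -> x = 0.
Proof.
by move=> /bdP/(_ j) T0; rewrite -[x]/(bfun (bimid _) x) -Fid T0 Fm0.
Qed.

Variable n : int.
Let ej i : i + (n - i) = n := subrKC i n.

(** The line i + j = n is infinite, but [T i j] vanishes as soon as |i| exceeds [bd], so the
    finitely many remaining terms suffice. *)
Lemma tot_id_sum : bimid (tot_bimod M N n)
  = \sum_(i <- zrange bd) bimcomp (tinj (ej i)) (tproj n i (n - i)).
Proof.
apply: bimhom_eq => f t; apply: tproj_eq => i j ij.
rewrite bfun_sum linear_sum /=.
have {}ij : j = n - i by rewrite -ij addrC addKr.
subst j.
have off i' : i' != i -> tval (bfun (tinj (ej i')) (tval t i' (n - i'))) i (n - i) = 0.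
  by move=> /eqP ii'; exact: tdelta0.
have [ib|bi] := leqP `|i| bd.
  rewrite (bigD1_seq i) ?zrange_uniq ?mem_zrange //= big1 ?addr0.
    by rewrite [RHS]tdelta_id.
  by move=> i' /off.
rewrite big1_seq.
  rewrite -[LHS]/(bfun (bimid _) (tval t i (n - i))).
  by rewrite (bdP bi).
move=> i' _; have [->|/off//] := eqVneq i' i.
by rewrite -[LHS]/(bfun (bimid _) _) (bdP bi).
Qed.

(** [F] carries the decomposition of the identity to one of [F (tot_bimod M N n)], in which every
    term kills [t]. It is applied with [F] the tensor product with a further bimodule, on either
    side. *)
Lemma joint_inj f (t : F (tot_bimod M N n) f) :
  (forall i j, i + j = n -> bfun (Fm (tproj n i j)) t = 0) -> t = 0.
Proof.
move=> t0; rewrite -[t]/(bfun (bimid _) t) -Fid tot_id_sum Fm_sum bfun_sum.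
by apply: big1 => i _; rewrite Fcomp /= t0 // linear0.
Qed.

Lemma joint_surj f (y : forall i j, F (T i j) f) :
  exists t : F (tot_bimod M N n) f,
    forall i j, i + j = n -> bfun (Fm (tproj n i j)) t = y i j.
Proof.
exists (\sum_(i <- zrange bd) bfun (Fm (tinj (ej i))) (y i (n - i))) => i j ij.
have {}ij : j = n - i by rewrite -ij addrC addKr.
(* Outside the range of the sum [F (T i j)] is zero, so the requirement holds trivially there. *)
subst j; have [ib|bi] := leqP `|i| bd; last by rewrite [LHS]Fzero ?[RHS]Fzero.
have FmE B B' B2 (v : bimhom B' B2) (u : bimhom B B') (x : F B f) :
    bfun (Fm v) (bfun (Fm u) x) = bfun (Fm (bimcomp v u)) x by rewrite Fcomp.
rewrite linear_sum /= (bigD1_seq i) ?zrange_uniq ?mem_zrange //= big1 ?addr0.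
  by rewrite FmE tproj_inj Fid.
by move=> i' /eqP ii'; rewrite FmE tproj_inj0 // Fm0.
Qed.
End AdditiveFunctor.
End TotalBiproduct.

(** * Tensor products of chain maps and of homotopies *)

Section TotalMap.
Variables (k : comPzRingType) (C : gradingCategory k) (A : galgebra C).

Section Lift.
Variables (M N : complex A) (n : int) (U : bimod A).
Variable w : forall i j : int, bimhom U (tens_bimod (M i) (N j)).
Hypothesis w_supp : forall i j, i + j <> n -> w i j = 0.

Fact tlift_supp f (x : U f) i j : i + j <> n -> bfun (w i j) x = 0.
Proof. by move=> /w_supp ->. Qed.

Definition tlift : bimhom U (tot_bimod M N n).
Proof.
exists (fun f x => Totc (@tlift_supp f x)).
- by move=> f c x y; apply: totc_eq => i j; exact: bfun_linear.
- by move=> X Y Z f g h e a x; apply: totc_eq => i j; exact: bfun_lact.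
- by move=> X Y Z f g h e x a; apply: totc_eq => i j; exact: bfun_ract.
Defined.
End Lift.

Lemma bimcomp0 (P Q R : bimod A) (u : bimhom Q R) : bimcomp u (0 : bimhom P Q) = 0.
Proof. by apply: bimhom_eq => f x; exact: linear0. Qed.

Variables (P P' X X' : complex A) (u : chmap P P') (v : chmap X X').

Fact chtot_supp n i j :
  i + j <> n -> bimcomp (tmap (cmap u i) (cmap v j)) (tproj P X n i j) = 0.
Proof. by move=> /tproj0 ->; exact: bimcomp0. Qed.

Definition chtot_map n : bimhom (tot_bimod P X n) (tot_bimod P' X' n) :=
  tlift (@chtot_supp n).

Fact chtot_cd (m n : int) (e : n = m + 1) f (t : tot P X m f) :
  bfun (chtot_map n) (bfun (cd (tot P X) e) t)
  = bfun (cd (tot P' X') e) (bfun (chtot_map m) t).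
Proof.
apply: totc_eq => i j /=; rewrite /tot_d_val /= linearD linearZ /=.
rewrite !tmap_fun_comp; congr (_ + _ *: _); apply: tmap_fun_eq => // g x.
  exact: cmap_cd.
exact: cmap_cd.
Qed.

Definition chtot : chmap (tot P X) (tot P' X') :=
  @Chmap _ _ _ (tot P X) (tot P' X') chtot_map chtot_cd.
End TotalMap.

Section TotalHomotopy.
Variables (k : comPzRingType) (C : gradingCategory k) (A : galgebra C).
Variables P P' X X' : complex A.

Lemma signD1 (i : int) : (-1) ^+ absz (i + 1) = - (-1) ^+ `|i|%N :> k.
Proof. by rewrite -{2}[i](addrK 1) signB1 opprK. Qed.

Lemma signD (i j : int) :
  (-1) ^+ absz (i + j) = (-1) ^+ `|i|%N * (-1) ^+ `|j|%N :> k.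
Proof.
rewrite -exprD -signr_odd -[RHS]signr_odd; congr (_ ^+ nat_of_bool _); lia.
Qed.

(** The homotopy is u ⊗ s with the sign (-1)^i of [s] passing a factor of degree i. The sign makes
    the two terms that contain both [s] and the differential of the first factor cancel. *)
Lemma chtot_homotopic_r (u : chmap P P') (v : chmap X X') :
  homotopic v 0 -> homotopic (chtot u v) 0.
Proof.
move=> [s sP].
pose w n i j : bimhom (tot_bimod P X n) (tens_bimod (P' i) (X' j)) :=
  (-1) ^+ `|i|%N *: bimcomp (tmap (cmap u i) (s j (j + 1) erefl)) (tproj P X n i (j + 1)).
have w_supp m n (e : n = m + 1) i j : i + j <> m -> w n i j = 0.
  by move=> ij; rewrite /w tproj0 ?bimcomp0 ?scaler0 // e addrA => /addIr.
exists (fun m n e => tlift (w_supp m n e)) => m n l e e' f t.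
rewrite !cmap0 !bfun0 subr0; apply: totc_eq => i j.
rewrite [RHS]tvalD /= /tot_d_val /=.
rewrite linearD !linearZ /= !tmap_fun_comp.
rewrite signB1 scaleNr scalerDr !scalerA -expr2 sqrr_sign !scale1r.
set a := tmap_fun _ _ (tval t (i - 1) _); set b := tmap_fun _ _ (tval t (i - 1) _).
have -> : a = b by apply: tmap_fun_eq => // g x; rewrite /= cmap_cd.
rewrite addrACA addNr add0r.
have -> : cmap v j = bimcomp (cdp X' j) (s (j - 1) j (esym (subrK 1 j)))
    + bimcomp (s j (j + 1) erefl) (cd X erefl).
  by apply: bimhom_eq => g x; rewrite bfunD -sP !cmap0 !bfun0 subr0.
rewrite -[LHS]/(bfun (tmap _ _) _) tmapDr bfunD; congr (_ + _).
  (* The degree j - 1 + 1 occurs in types; a variable [p] with [p = j] in its place makes the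
     substitution possible. *)
  have E p : p = j -> forall ep : p = j - 1 + 1,
      tmap_fun (bimcomp (bimid _) (cmap u i)) (bimcomp (cdp X' j) (s (j - 1) p ep))
        (tval t i p)
      = tmap_fun (cmap u i) (bimcomp (cdp X' j) (s (j - 1) j (esym (subrK 1 j))))
        (tval t i j).
    move=> -> ep; rewrite (Prop_irrelevance ep (esym (subrK 1 j))).
    exact: tmap_fun_eq.
  by rewrite E // subrK.
have E p : p = j -> forall ep : j + 1 = p + 1,
    tmap_fun (bimcomp (cmap u i) (bimid _)) (bimcomp (s j (j + 1) erefl) (cd X ep))
      (tval t i p)
    = tmap_fun (cmap u i) (bimcomp (s j (j + 1) erefl) (cd X erefl)) (tval t i j).
  move=> -> ep; rewrite (Prop_irrelevance ep erefl).
  exact: tmap_fun_eq.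
by rewrite E // addrK.
Qed.

(** The homotopy s ⊗ v takes no sign: it meets the differential of the second factor in first
    degrees i and i + 1, where the signs of the total differential are opposite. *)
Lemma chtot_homotopic_l (u : chmap P P') (v : chmap X X') :
  homotopic u 0 -> homotopic (chtot u v) 0.
Proof.
move=> [s sP].
pose w n i j : bimhom (tot_bimod P X n) (tens_bimod (P' i) (X' j)) :=
  bimcomp (tmap (s i (i + 1) erefl) (cmap v j)) (tproj P X n (i + 1) j).
have w_supp m n (e : n = m + 1) i j : i + j <> m -> w n i j = 0.
  by move=> ij; rewrite /w tproj0 ?bimcomp0 // e addrAC => /addIr.
exists (fun m n e => tlift (w_supp m n e)) => m n l e e' f t.
rewrite !cmap0 !bfun0 subr0; apply: totc_eq => i j.
rewrite [RHS]tvalD /= /tot_d_val /=.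
rewrite linearD !linearZ /= !tmap_fun_comp signD1 scaleNr.
set a := tmap_fun _ _ (tval t (i + 1) (j - 1)).
set b := tmap_fun _ _ (tval t (i + 1) (j - 1)).
have -> : a = b by apply: tmap_fun_eq => // g x; rewrite /= cmap_cd.
rewrite addrACA subrr addr0.
have -> : cmap u i = bimcomp (cdp P' i) (s (i - 1) i (esym (subrK 1 i)))
    + bimcomp (s i (i + 1) erefl) (cd P erefl).
  by apply: bimhom_eq => g x; rewrite bfunD -sP !cmap0 !bfun0 subr0.
rewrite -[LHS]/(bfun (tmap _ _) _) tmapDl bfunD; congr (_ + _).
  have E p : p = i -> forall ep : p = i - 1 + 1,
      tmap_fun (bimcomp (cdp P' i) (s (i - 1) p ep)) (bimcomp (bimid _) (cmap v j))
        (tval t p j)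
      = tmap_fun (bimcomp (cdp P' i) (s (i - 1) i (esym (subrK 1 i)))) (cmap v j)
        (tval t i j).
    move=> -> ep; rewrite (Prop_irrelevance ep (esym (subrK 1 i))).
    exact: tmap_fun_eq.
  by rewrite E // subrK.
have E p : p = i -> forall ep : i + 1 = p + 1,
    tmap_fun (bimcomp (s i (i + 1) erefl) (cd P ep)) (bimcomp (cmap v j) (bimid _))
      (tval t p j)
    = tmap_fun (bimcomp (s i (i + 1) erefl) (cd P erefl)) (cmap v j) (tval t i j).
  move=> -> ep; rewrite (Prop_irrelevance ep erefl).
  exact: tmap_fun_eq.
by rewrite E // addrK.
Qed.
End TotalHomotopy.

(** * The associator of complexes *)

Section TotalAssociator.
Variables (k : comPzRingType) (C : gradingCategory k) (A : galgebra C).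
Variables P N X : complex A.
Local Notation T i j l := (tens_bimod (P i) (tens_bimod (N j) (X l))).

(* Both triple products are determined by their components in the
   P_i ⊗ (N_j ⊗ X_l). The degree m of the inner total complex (i + j, resp.
   j + l) is a separate argument, so that no cast between equal degrees such
   as j - 1 + l and j + l - 1 is needed. *)
Definition lcomp n m i j l : bimhom (tot (tot P N) X n) (T i j l) :=
  bimcomp (bassoc (P i) (N j) (X l))
    (bimcomp (tmap (tproj P N m i j) (bimid (X l))) (tproj (tot P N) X n m l)).

Definition rcomp n m i j l : bimhom (tot P (tot N X) n) (T i j l) :=
  bimcomp (tmap (bimid (P i)) (tproj N X m j l)) (tproj P (tot N X) n i m).

Section Functors.
Variable B : bimod A.
Lemma tmapl_comp Q Q' Q2 (v : bimhom Q' Q2) (u : bimhom Q Q') :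
  tmap (bimcomp v u) (bimid B) = bimcomp (tmap v (bimid B)) (tmap u (bimid B)).
Proof. by rewrite -tmap_comp; congr tmap; exact: bimhom_eq. Qed.
Lemma tmapr_comp Q Q' Q2 (v : bimhom Q' Q2) (u : bimhom Q Q') :
  tmap (bimid B) (bimcomp v u) = bimcomp (tmap (bimid B) v) (tmap (bimid B) u).
Proof. by rewrite -tmap_comp; congr tmap; exact: bimhom_eq. Qed.
End Functors.

(** The components of the outer product separate elements by definition, those of the inner one,
    tensored with P_i, by [joint_inj]. *)
Lemma rcomp_inj n f (t : tot P (tot N X) n f) :
  (forall i j l, bfun (rcomp n (j + l) i j l) t = 0) -> t = 0.
Proof.
move=> t0; apply: (@tproj_eq _ _ _ P (tot N X)) => i m im; rewrite linear0.
apply: (joint_inj (F := tens_bimod (P i)) (Fm := fun B B' => tmap (bimid (P i)))).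
- by move=> B; exact: tmap_id.
- by move=> B B' B2 v u; exact: tmapr_comp.
- by move=> B B' u v; exact: tmapDr.
by move=> j l jl; subst m; exact: t0.
Qed.

Lemma lcomp_inj n f (t : tot (tot P N) X n f) :
  (forall i j l, bfun (lcomp n (i + j) i j l) t = 0) -> t = 0.
Proof.
move=> t0; apply: (@tproj_eq _ _ _ (tot P N) X) => m l ml; rewrite linear0.
apply: (joint_inj (F := fun B => tens_bimod B (X l))
  (Fm := fun B B' (u : bimhom B B') => tmap u (bimid (X l)))).
- by move=> B; exact: tmap_id.
- by move=> B B' B2 v u; exact: tmapl_comp.
- by move=> B B' u v; exact: tmapDl.
move=> i j ij; subst m.
(* The hypothesis concerns the component after [bassoc], which [bassocK] undoes. *)
by rewrite -[LHS]bassocK [X in tens_lift _ X]t0 tens_lift0 //; exact: assocV_fun_bal.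
Qed.

Lemma rcomp_surj n f (y : forall i j l, T i j l f) :
  (forall i j l, i + j + l <> n -> y i j l = 0) ->
  exists t : tot P (tot N X) n f,
    forall i j l, bfun (rcomp n (j + l) i j l) t = y i j l.
Proof.
move=> y0.
have ex i m : exists s : tens_bimod (P i) (tot N X m) f,
    forall j l, j + l = m -> bfun (tmap (bimid (P i)) (tproj N X m j l)) s = y i j l.
  apply: (joint_surj (F := tens_bimod (P i)) (Fm := fun B B' => tmap (bimid (P i)))).
  - by move=> B; exact: tmap_id.
  - by move=> B B' B2 v u; exact: tmapr_comp.
  - by move=> B B' u v; exact: tmapDr.
(* Membership in the total product forces the value zero off the line i + m = n; this agrees with
   [y] by the hypothesis on its support. *)
pose s i m : tens_bimod (P i) (tot N X m) f :=
  if i + m == n then projT1 (cid (ex i m)) else 0.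
have s0 i m : i + m <> n -> s i m = 0 by rewrite /s; case: eqP.
exists (Totc (M := P) (N := tot N X) s0) => i j l.
rewrite -[LHS]/(bfun (tmap (bimid (P i)) (tproj N X (j + l) j l)) (s i (j + l))).
have [ijl|/eqP ijl] := eqVneq (i + (j + l)) n.
  by rewrite /s ijl eqxx; case: cid => /= x xP; exact: xP.
by rewrite s0 // linear0 y0 // -addrA.
Qed.

Lemma lcomp_surj n f (y : forall i j l, T i j l f) :
  (forall i j l, i + j + l <> n -> y i j l = 0) ->
  exists t : tot (tot P N) X n f,
    forall i j l, bfun (lcomp n (i + j) i j l) t = y i j l.
Proof.
move=> y0.
(* The prescribed components are first moved to (P ⊗ N) ⊗ X, where [joint_surj] applies. *)
pose z i j l : tens_bimod (tens_bimod (P i) (N j)) (X l) f :=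
  tens_lift (@assocV_fun _ _ _ (P i) (N j) (X l) f) (y i j l).
have ex m l : exists s : tens_bimod (tot P N m) (X l) f,
    forall i j, i + j = m -> bfun (tmap (tproj P N m i j) (bimid (X l))) s = z i j l.
  apply: (joint_surj (F := fun B => tens_bimod B (X l))
    (Fm := fun B B' (u : bimhom B B') => tmap u (bimid (X l)))).
  - by move=> B; exact: tmap_id.
  - by move=> B B' B2 v u; exact: tmapl_comp.
  - by move=> B B' u v; exact: tmapDl.
pose s m l : tens_bimod (tot P N m) (X l) f :=
  if m + l == n then projT1 (cid (ex m l)) else 0.
have s0 m l : m + l <> n -> s m l = 0 by rewrite /s; case: eqP.
exists (Totc (M := tot P N) (N := X) s0) => i j l.
rewrite -[LHS]/(bfun (bassoc _ _ _)
  (bfun (tmap (tproj P N (i + j) i j) (bimid (X l))) (s (i + j) l))).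
have [ijl|/eqP ijl] := eqVneq (i + j + l) n.
  rewrite /s ijl eqxx; case: cid => /= x xP.
  by rewrite [X in bfun _ X](xP _ _ erefl) bassocVK.
by rewrite s0 // !linear0 y0.
Qed.

Lemma lcomp0 n i j l : i + j + l <> n -> lcomp n (i + j) i j l = 0.
Proof. by move=> ijl; rewrite /lcomp (tproj0 _ _ ijl) !bimcomp0. Qed.

Lemma rcomp0 n i j l : i + j + l <> n -> rcomp n (j + l) i j l = 0.
Proof. by rewrite -addrA => ijl; rewrite /rcomp (tproj0 _ _ ijl) bimcomp0. Qed.

(** The associator preserves triple components without any sign: [rcomp_surj] solves for it and
    [rcomp_inj] makes the solution unique. *)
Lemma tassoc_ex n : {w : bimhom (tot (tot P N) X n) (tot P (tot N X) n) |
  forall i j l f (t : tot (tot P N) X n f),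
    bfun (rcomp n (j + l) i j l) (bfun w t) = bfun (lcomp n (i + j) i j l) t}.
Proof.
have [|| w wE] := @bimhom_solve _ _ _ (tot (tot P N) X n) (tot P (tot N X) n)
  (int * int * int) (fun I => T I.1.1 I.1.2 I.2)
  (fun I => lcomp n (I.1.1 + I.1.2) I.1.1 I.1.2 I.2)
  (fun I => rcomp n (I.1.2 + I.2) I.1.1 I.1.2 I.2).
- move=> f t.
  have [|u uE] := @rcomp_surj n f (fun i j l => bfun (lcomp n (i + j) i j l) t).
    by move=> i j l /lcomp0 ->.
  by exists u => -[[i j] l]; exact: uE.
- by move=> f t t0; apply: rcomp_inj => i j l; exact: (t0 (i, j, l)).
by exists w => i j l; exact: (wE (i, j, l)).
Qed.

Definition tassoc_map n := sval (tassoc_ex n).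

Lemma tassoc_mapE n m m' i j l f (t : tot (tot P N) X n f) : m = j + l -> m' = i + j ->
  bfun (rcomp n m i j l) (bfun (tassoc_map n) t) = bfun (lcomp n m' i j l) t.
Proof. by move=> -> ->; rewrite (svalP (tassoc_ex n)). Qed.

Lemma tassoc_map_inj n f (t : tot (tot P N) X n f) : bfun (tassoc_map n) t = 0 -> t = 0.
Proof.
move=> t0; apply: lcomp_inj => i j l.
by rewrite -(tassoc_mapE t erefl erefl) t0 linear0.
Qed.

Lemma tassoc_map_surj n f (t : tot P (tot N X) n f) : exists u, bfun (tassoc_map n) u = t.
Proof.
have [|u uE] := @lcomp_surj n f (fun i j l => bfun (rcomp n (j + l) i j l) t).
  by move=> i j l /rcomp0 ->.
exists u; apply/eqP; rewrite -subr_eq0; apply/eqP/rcomp_inj => i j l.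
by rewrite bfunB (tassoc_mapE u erefl erefl) uE subrr.
Qed.

Lemma tproj_cdp (P' Q' : complex A) m i j :
  bimcomp (tproj P' Q' m i j) (cdp (tot P' Q') m)
  = bimcomp (tmap (cdp P' i) (bimid _)) (tproj P' Q' (m - 1) (i - 1) j)
  + (-1) ^+ `|i|%N *: bimcomp (tmap (bimid _) (cdp Q' j)) (tproj P' Q' (m - 1) i (j - 1)).
Proof. exact: bimhom_eq. Qed.

(** The three terms carry the signs 1, (-1)^i and (-1)^i (-1)^j, exactly as in [lcomp_cd]; this
    agreement makes the associator a chain map. *)
Lemma rcomp_cd m n (e : n = m + 1) p i j l f (t : tot P (tot N X) m f) :
  bfun (rcomp n p i j l) (bfun (cd (tot P (tot N X)) e) t)
  = bfun (tmap (cdp P i) (bimid _)) (bfun (rcomp m p (i - 1) j l) t)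
  + ((-1) ^+ `|i|%N *: bfun (tmap (bimid _) (tmap (cdp N j) (bimid _)))
       (bfun (rcomp m (p - 1) i (j - 1) l) t)
     + (-1) ^+ `|i|%N *: ((-1) ^+ `|j|%N *:
       bfun (tmap (bimid _) (tmap (bimid _) (cdp X l)))
       (bfun (rcomp m (p - 1) i j (l - 1)) t))).
Proof.
rewrite -[LHS]/(tmap_fun _ _ (tot_d_val t i p)) /tot_d_val.
rewrite linearD linearZ /= !tmap_fun_comp tproj_cdp.
rewrite tmap_funDr tmap_funZr scalerDr.
congr (_ + (_ *: _ + _ *: (_ *: _))); exact: tmap_fun_eq.
Qed.

(** The last sign arises as (-1)^p, with [p] the degree in P ⊗ N, and splits because [p = i + j].
    The differentials pass through the associator by [bassoc_nat]. *)
Lemma lcomp_cd m n (e : n = m + 1) p i j l f (t : tot (tot P N) X m f) : p = i + j ->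
  bfun (lcomp n p i j l) (bfun (cd (tot (tot P N) X) e) t)
  = bfun (tmap (cdp P i) (bimid _)) (bfun (lcomp m (p - 1) (i - 1) j l) t)
  + ((-1) ^+ `|i|%N *: bfun (tmap (bimid _) (tmap (cdp N j) (bimid _)))
       (bfun (lcomp m (p - 1) i (j - 1) l) t)
     + (-1) ^+ `|i|%N *: ((-1) ^+ `|j|%N *:
       bfun (tmap (bimid _) (tmap (bimid _) (cdp X l)))
       (bfun (lcomp m p i j (l - 1)) t))).
Proof.
move=> pij.
have nat P1 N1 X1 P2 N2 X2 (u : bimhom P1 P2) (v : bimhom N1 N2) (w : bimhom X1 X2)
    (x : tens_bimod (tens_bimod P1 N1) X1 f) :
    bfun (tmap u (tmap v w)) (bfun (bassoc P1 N1 X1) x)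
    = bfun (bassoc P2 N2 X2) (bfun (tmap (tmap u v) w) x).
  by rewrite -[LHS]/(bfun (bimcomp _ _) x) -bassoc_nat.
rewrite -[bfun (lcomp m (p - 1) (i - 1) j l) t]/(bfun (bassoc _ _ _) _).
rewrite -[bfun (lcomp m (p - 1) i (j - 1) l) t]/(bfun (bassoc _ _ _) _).
rewrite -[bfun (lcomp m p i j (l - 1)) t]/(bfun (bassoc _ _ _) _).
rewrite -{1}(tmap_id (N j) (X l)) !nat.
rewrite -[LHS]/(bfun (bassoc _ _ _) (tmap_fun _ _ (tot_d_val t p l))) /tot_d_val.
rewrite -!bfun_scale -!bfun_add; congr (bfun (bassoc _ _ _) _).
rewrite linearD linearZ /= !tmap_fun_comp tproj_cdp.
rewrite tmap_funDl tmap_funZl -addrA.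
rewrite scalerA -signD -pij !linearZ /= tmap_fun_comp.
congr (_ + (_ *: _ + _ *: _)); apply: tmap_fun_eq => // g x.
by rewrite tmap_id.
Qed.

Lemma tassoc_map_cd m n (e : n = m + 1) f (t : tot (tot P N) X m f) :
  bfun (tassoc_map n) (bfun (cd (tot (tot P N) X) e) t)
  = bfun (cd (tot P (tot N X)) e) (bfun (tassoc_map m) t).
Proof.
apply/eqP; rewrite -subr_eq0; apply/eqP/rcomp_inj => i j l.
rewrite bfunB (tassoc_mapE _ erefl erefl) rcomp_cd lcomp_cd //.
rewrite !(@tassoc_mapE m _ (i - 1 + j) (i - 1)) //.
rewrite !(@tassoc_mapE m _ (i + (j - 1)) i (j - 1)) //; last by ring.
rewrite !(@tassoc_mapE m _ (i + j) i j (l - 1)) //; last by ring.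
have -> : i + j - 1 = i - 1 + j by ring.
have -> : i - 1 + j = i + (j - 1) by ring.
by rewrite subrr.
Qed.

Definition tassoc : chmap (tot (tot P N) X) (tot P (tot N X)) :=
  @Chmap _ _ _ (tot (tot P N) X) (tot P (tot N X)) tassoc_map tassoc_map_cd.
End TotalAssociator.

Section AssociatorNatural.
Variables (k : comPzRingType) (C : gradingCategory k) (A : galgebra C).
Variables (P N X Y : complex A) (v : chmap X Y).

Lemma tassoc_nat :
  chcomp (tassoc P N Y) (chtot (chid (tot P N)) v)
  = chcomp (chtot (chid P) (chtot (chid N) v)) (tassoc P N X).
Proof.
apply: chmap_eq => n f t.
apply/eqP; rewrite -subr_eq0; apply/eqP/rcomp_inj => i j l.
rewrite bfunB -[bfun (cmap (chcomp (tassoc _ _ _) _) n) t]/(bfun (tassoc_map P N Y n) _).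
rewrite (tassoc_mapE _ erefl erefl).
have -> : bfun (rcomp P N Y n (j + l) i j l)
    (bfun (cmap (chcomp (chtot (chid P) (chtot (chid N) v)) (tassoc P N X)) n) t)
  = bfun (tmap (bimid _) (tmap (bimid _) (cmap v l)))
      (bfun (rcomp P N X n (j + l) i j l) (bfun (tassoc_map P N X n) t)).
  rewrite /= !tmap_fun_comp; exact: tmap_fun_eq.
rewrite (tassoc_mapE _ erefl erefl) /lcomp /= !tmap_fun_comp.
rewrite -[X in _ - X]/(bfun (bimcomp (tmap _ _) (bassoc _ _ _)) _) -bassoc_nat /=.
rewrite tmap_fun_comp tmap_id; apply/eqP; rewrite subr_eq0; apply/eqP.
by congr (bfun (bassoc _ _ _) _); apply: tmap_fun_eq.
Qed.
End AssociatorNatural.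

(** * The left unitor of complexes *)

Section TotalUnitor.
Variables (k : comPzRingType) (C : gradingCategory k) (A : galgebra C).
Local Notation I := (single (regular A)).

Lemma lunit_nat (Q R : bimod A) (u : bimhom Q R) :
  bimcomp (lunit R) (tmap (bimid (regular A)) u) = bimcomp u (lunit Q).
Proof.
apply: tens_bimhom_eq; case=> Z W h Y f g /= e a x.
rewrite tmap_funE [LHS]lunitE.
by rewrite [X in _ = bfun u X]lunitE bfun_lact.
Qed.

Variable X : complex A.

(** [A] sits in degree 0, so the summand with indices (0, n) is the whole of degree n. *)
Definition tlunit_map n : bimhom (tot I X n) (X n) :=
  bimcomp (lunit (X n)) (tproj I X n 0 n).

Fact tlunit_cd (m n : int) (e : n = m + 1) f (t : tot I X m f) :
  bfun (tlunit_map n) (bfun (cd (tot I X) e) t) = bfun (cd X e) (bfun (tlunit_map m) t).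
Proof.
rewrite -[LHS]/(bfun (lunit (X n)) (tot_d_val t 0 n)) /tot_d_val expr0 scale1r.
(* The term with the differential of [single] vanishes, that differential being zero. *)
rewrite [X in X + _]tmap_fun0l // add0r.
rewrite -[LHS]/(bfun (bimcomp (lunit (X n)) (tmap (bimid (regular A)) _)) _) lunit_nat.
have E p : p = m -> forall ep : n = p + 1,
    bfun (bimcomp (cd X ep) (lunit (X p))) (tval t 0 p)
    = bfun (cd X e) (bfun (lunit (X m)) (tval t 0 m)).
  by move=> -> ep; rewrite (Prop_irrelevance ep e).
by apply: E; rewrite e addrK.
Qed.

Definition tlunit : chmap (tot I X) X := @Chmap _ _ _ (tot I X) X tlunit_map tlunit_cd.

Lemma tlunit_map_inj n f (t : tot I X n f) : bfun (tlunit_map n) t = 0 -> t = 0.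
Proof.
move=> /lunit_inj t0; apply: (@tproj_eq _ _ _ I X) => i j ij.
rewrite linear0; have [i0|/negPf i0] := eqVneq i 0.
  by move: ij t0; rewrite i0 add0r => ->.
move: (bfun _ t); apply: tens_indp => // [u v -> ->|Y g h e x y].
  by rewrite addr0.
suff -> : x = 0 by rewrite tpure0l.
by move: x; rewrite /= i0 => x; exact: zero_bimod_eq.
Qed.

Lemma tlunit_map_surj n f (x : X n f) : exists t, bfun (tlunit_map n) t = x.
Proof.
have [s <-] := lunit_surj x.
exists (bfun (tinj I X (add0r n)) s).
rewrite -[X in _ = bfun _ X]/(bfun (bimid (tens_bimod (I 0) (X n))) s).
by rewrite -(tproj_inj I X (add0r n)).
Qed.
End TotalUnitor.

Lemma tlunit_nat (k : comPzRingType) (C : gradingCategory k) (A : galgebra C)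
    (X Y : complex A) (v : chmap X Y) :
  chcomp (tlunit Y) (chtot (chid (single (regular A))) v) = chcomp v (tlunit X).
Proof.
apply: chmap_eq => n f t.
rewrite -[LHS]/(bfun (bimcomp (lunit (Y n)) (tmap (bimid (regular A)) (cmap v n))) _).
by rewrite lunit_nat.
Qed.

(** * The homotopy category *)

Section TotalHomK.
Variables (k : comPzRingType) (C : gradingCategory k) (A : galgebra C).

Lemma chtot_comp (P P' P2 X X' X2 : complex A) (u : chmap P P') (u' : chmap P' P2)
    (v : chmap X X') (v' : chmap X' X2) :
  chtot (chcomp u' u) (chcomp v' v) = chcomp (chtot u' v') (chtot u v).
Proof. by apply: chmap_eq => n f t; apply: totc_eq => i j /=; rewrite tmap_fun_comp. Qed.

Lemma chtot_id (P X : complex A) : chtot (chid P) (chid X) = chid (tot P X).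
Proof.
apply: chmap_eq => n f t; apply: totc_eq => i j.
by rewrite -[LHS]/(bfun (tmap (bimid _) (bimid _)) (tval t i j)) tmap_id.
Qed.

Lemma chcomp1 (X Y : complex A) (u : chmap X Y) : chcomp u (chid X) = u.
Proof. exact: chmap_eq. Qed.
Lemma ch1comp (X Y : complex A) (u : chmap X Y) : chcomp (chid Y) u = u.
Proof. exact: chmap_eq. Qed.

Section Linear.
Variables (P P' X X' : complex A).

Lemma chtot_linear_r (u : chmap P P') : linear (chtot u : chmap X X' -> _).
Proof.
move=> c v v'; apply: chmap_eq => n f t; apply: totc_eq => i j.
rewrite -[RHS]/(c *: tmap_fun _ _ (tval t i j) + tmap_fun _ _ (tval t i j)).
by rewrite /= tmap_funDr tmap_funZr.
Qed.

Lemma chtot_linear_l (v : chmap X X') : linear (fun u : chmap P P' => chtot u v).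
Proof.
move=> c u u'; apply: chmap_eq => n f t; apply: totc_eq => i j.
rewrite -[RHS]/(c *: tmap_fun _ _ (tval t i j) + tmap_fun _ _ (tval t i j)).
by rewrite /= tmap_funDl tmap_funZl.
Qed.

Lemma chtot_homotopy_r (u : chmap P P') (v v' : chmap X X') :
  homotopic v v' -> homotopic (chtot u v) (chtot u v').
Proof.
move=> /homotopicE/(chtot_homotopic_r u) vv; apply/homotopicE.
have := chtot_linear_r u (-1) v' v.
by rewrite !scaleN1r ![- _ + _]addrC => <-.
Qed.

Lemma chtot_homotopy_l (u u' : chmap P P') (v : chmap X X') :
  homotopic u u' -> homotopic (chtot u v) (chtot u' v).
Proof.
move=> /homotopicE/(chtot_homotopic_l v) uu; apply/homotopicE.
have := chtot_linear_l v (-1) u' u.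
by rewrite !scaleN1r ![- _ + _]addrC => <-.
Qed.
End Linear.

Definition totr (P X Y : complex A) (f : homK X Y) : homK (tot P X) (tot P Y) :=
  \pi_(homK (tot P X) (tot P Y)) (chtot (chid P) (repr f)).

Definition totl (X P P' : complex A) (f : homK P P') : homK (tot P X) (tot P' X) :=
  \pi_(homK (tot P X) (tot P' X)) (chtot (repr f) (chid X)).

Lemma totr_pi P X Y (v : chmap X Y) :
  totr P (\pi_(homK X Y) v) = \pi_(homK (tot P X) (tot P Y)) (chtot (chid P) v).
Proof.
by apply/eqP/homK_piP/chtot_homotopy_r; apply/homK_piP; rewrite reprK.
Qed.

Lemma totl_pi X P P' (u : chmap P P') :
  totl X (\pi_(homK P P') u) = \pi_(homK (tot P X) (tot P' X)) (chtot u (chid X)).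
Proof.
by apply/eqP/homK_piP/chtot_homotopy_l; apply/homK_piP; rewrite reprK.
Qed.

Lemma totr_comp P X Y Z (g : homK Y Z) (f : homK X Y) :
  totr P (compK g f) = compK (totr P g) (totr P f).
Proof.
elim/quotW: f => f; elim/quotW: g => g.
by rewrite (compK_pi g f) !totr_pi compK_pi -chtot_comp ch1comp.
Qed.

Lemma totr_id P X : totr P (idK X) = idK (tot P X).
Proof. by rewrite totr_pi chtot_id. Qed.

Lemma totl_comp X P P' P2 (g : homK P' P2) (f : homK P P') :
  totl X (compK g f) = compK (totl X g) (totl X f).
Proof.
elim/quotW: f => f; elim/quotW: g => g.
by rewrite (compK_pi g f) !totl_pi compK_pi -chtot_comp ch1comp.
Qed.

Lemma totl_id X P : totl X (idK P) = idK (tot P X).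
Proof. by rewrite totl_pi chtot_id. Qed.

Lemma totl_totr P P' X Y (g : homK P P') (f : homK X Y) :
  compK (totl Y g) (totr P f) = compK (totr P' f) (totl X g).
Proof.
elim/quotW: f => f; elim/quotW: g => g.
rewrite (totl_pi Y g) (totr_pi P f) (totl_pi X g) (totr_pi P' f) !compK_pi.
by rewrite -!chtot_comp !ch1comp !chcomp1.
Qed.

Lemma homK_piZD (X Y : complex A) c (u v : chmap X Y) :
  \pi_(homK X Y) (c *: u + v) = c *: \pi_(homK X Y) u + \pi_(homK X Y) v.
Proof. by rewrite -homK_piD -scaleK_pi. Qed.

Lemma totr_linear P X Y : linear (@totr P X Y).
Proof.
move=> c; elim/quotW=> f; elim/quotW=> g.
by rewrite -homK_piZD !totr_pi chtot_linear_r homK_piZD.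
Qed.

Lemma compK_linear_r (X Y Z : complex A) (g : homK Y Z) :
  linear (@compK k C A X Y Z g).
Proof.
move=> c; elim/quotW=> f; elim/quotW=> f'; elim/quotW: g => g.
rewrite -homK_piZD (compK_pi g f) (compK_pi g f') compK_pi -homK_piZD.
congr (\pi_(homK X Z) _); apply: chmap_eq => i h x /=.
by rewrite linearP.
Qed.

Lemma compK_linear_l (X Y Z : complex A) (f : homK X Y) :
  linear (fun g : homK Y Z => compK g f).
Proof.
move=> c; elim/quotW=> g; elim/quotW=> g'; elim/quotW: f => f.
rewrite -homK_piZD (compK_pi g f) (compK_pi g' f) compK_pi -homK_piZD.
congr (\pi_(homK X Z) _); exact: chmap_eq.
Qed.

Lemma isoK_pi (X Y : complex A) (u : chmap X Y) (v : chmap Y X) :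
  chcomp v u = chid X -> chcomp u v = chid Y ->
  compK (\pi_(homK Y X) v) (\pi_(homK X Y) u) = idK X
  /\ compK (\pi_(homK X Y) u) (\pi_(homK Y X) v) = idK Y.
Proof. by move=> vu uv; rewrite !compK_pi vu uv. Qed.

Lemma isoK_comp (X Y Z : complex A) (f : homK X Y) (f' : homK Y X) (g : homK Y Z)
    (g' : homK Z Y) :
  compK f' f = idK X /\ compK f f' = idK Y ->
  compK g' g = idK Y /\ compK g g' = idK Z ->
  compK (compK f' g') (compK g f) = idK X /\ compK (compK g f) (compK f' g') = idK Z.
Proof.
move=> [f1 f2] [g1 g2]; split.
  by rewrite compKA -(compKA f') g1 compK1.
by rewrite compKA -(compKA g) f2 compK1.
Qed.

Local Notation I := (single (regular A)).

(** * Tensoring with an invertible complex is fully faithful *)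

Section Cancel.
Variables P Q : complex A.
Hypothesis PQ : isoK (tot P Q) I.

(* th is the composite P ⊗ (Q ⊗ X) -> (P ⊗ Q) ⊗ X -> I ⊗ X -> X. *)
Lemma cancel_iso : exists (th : forall X, homK (tot P (tot Q X)) X)
    (th' : forall X, homK X (tot P (tot Q X))),
  (forall X, compK (th' X) (th X) = idK _ /\ compK (th X) (th' X) = idK X) /\
  (forall X Y (f : homK X Y), compK (th Y) (totr P (totr Q f)) = compK f (th X)).
Proof.
have [e [e' [e'e ee']]] := PQ.
have tassoc_inv X := chmap_inv (u := tassoc P Q X)
  (@tassoc_map_inj _ _ _ P Q X) (@tassoc_map_surj _ _ _ P Q X).
have tlunit_inv (X : complex A) := chmap_inv (u := tlunit X)
  (@tlunit_map_inj _ _ _ X) (@tlunit_map_surj _ _ _ X).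
pose a X : homK (tot (tot P Q) X) (tot P (tot Q X)) := \pi_(homK _ _) (tassoc P Q X).
pose a' X : homK (tot P (tot Q X)) (tot (tot P Q) X) :=
  \pi_(homK _ _) (projT1 (cid (tassoc_inv X))).
pose l X : homK (tot I X) X := \pi_(homK _ _) (tlunit X).
pose l' X : homK X (tot I X) := \pi_(homK _ _) (projT1 (cid (tlunit_inv X))).
have aK X : compK (a' X) (a X) = idK _ /\ compK (a X) (a' X) = idK _.
  by rewrite /a /a'; case: cid => v /= [? ?]; exact: isoK_pi.
have lK X : compK (l' X) (l X) = idK _ /\ compK (l X) (l' X) = idK _.
  by rewrite /l /l'; case: cid => v /= [? ?]; exact: isoK_pi.
have a_nat X Y (f : homK X Y) :
    compK (a Y) (totr (tot P Q) f) = compK (totr P (totr Q f)) (a X).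
  elim/quotW: f => f; rewrite (totr_pi Q f) (totr_pi (tot P Q) f) totr_pi !compK_pi.
  by rewrite tassoc_nat.
have l_nat X Y (f : homK X Y) : compK (l Y) (totr I f) = compK f (l X).
  by elim/quotW: f => f; rewrite (totr_pi I f) !compK_pi tlunit_nat.
have a'_nat X Y (f : homK X Y) :
    compK (a' Y) (totr P (totr Q f)) = compK (totr (tot P Q) f) (a' X).
  rewrite -[LHS]compK1 -(aK X).2 compKA -(compKA (a' Y)) -a_nat.
  by rewrite (compKA (a' Y)) (aK Y).1 comp1K.
exists (fun X => compK (l X) (compK (totl X e) (a' X))).
exists (fun X => compK (compK (a X) (totl X e')) (l' X)).
split=> [X|X Y f].
  have eK : compK (totl X e') (totl X e) = idK _ /\ compK (totl X e) (totl X e') = idK _.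
    by rewrite -!totl_comp e'e ee' !totl_id.
  have [a1 a2] := isoK_comp (conj (aK X).2 (aK X).1) eK.
  exact: isoK_comp (conj a1 a2) (lK X).
by rewrite -!compKA a'_nat (compKA (totl Y e)) totl_totr -compKA compKA l_nat -compKA.
Qed.

(** Naturality of the isomorphism [th] recovers [f] from Q ⊗ f, as the conjugate by [th] of P ⊗ (Q ⊗
    f). *)
Lemma totr_inj X Y : injective (@totr Q X Y).
Proof.
have [th [th' [thK nat]]] := cancel_iso.
have fE (f : homK X Y) : f = compK (compK (th Y) (totr P (totr Q f))) (th' X).
  by rewrite nat -compKA (thK X).2 compK1.
by move=> f g fg; rewrite (fE f) (fE g) fg.
Qed.
End Cancel.

(** The candidate is the conjugate by [th] of P ⊗ g. Naturality gives P ⊗ (Q ⊗ f) = P ⊗ g, and P ⊗ -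
    is faithful by [totr_inj] with the roles of [P] and [Q] exchanged. *)
Lemma totr_surj P Q : isoK (tot P Q) I -> isoK (tot Q P) I ->
  forall X Y (g : homK (tot Q X) (tot Q Y)), exists f, totr Q f = g.
Proof.
move=> PQ QP X Y g; have [th [th' [thK nat]]] := cancel_iso PQ.
exists (compK (compK (th Y) (totr P g)) (th' X)); apply: (totr_inj QP).
set f := compK _ (th' X).
rewrite -[LHS]comp1K -(thK Y).1 -compKA nat /f -!compKA (thK X).1 compK1.
by rewrite compKA (thK Y).1 comp1K.
Qed.

(** * Endomorphisms of a complex concentrated in degree 0 *)

Section EndSingle.
Variable B : bimod A.

Definition single_val (f : homK (single B) (single B)) : bimhom B B := cmap (repr f) 0.

(** Both terms of a homotopy contain the differential of [single B], which is zero, so the choice of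
    representative does not matter. *)
Lemma single_val_pi (u : chmap (single B) (single B)) :
  single_val (\pi_(homK _ _) u) = cmap u 0.
Proof.
have : homotopic (repr (\pi_(homK _ _) u)) u by apply/homK_piP; rewrite reprK.
move=> [s sP]; apply: bimhom_eq => f x; apply/eqP; rewrite -subr_eq0.
have -> := sP (-1) 0 1 erefl erefl f x.
by rewrite linear0 addr0.
Qed.

Lemma single_val_linear : linear single_val.
Proof.
move=> c; elim/quotW=> u; elim/quotW=> v.
by rewrite -homK_piZD !single_val_pi.
Qed.

Lemma single_val_comp f g : single_val (compK f g) = bimcomp (single_val f) (single_val g).
Proof.
elim/quotW: f => u; elim/quotW: g => v.
by rewrite compK_pi !single_val_pi.
Qed.

Lemma single_val_id : single_val (idK _) = bimid B.
Proof. exact: single_val_pi. Qed.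

Lemma single_eq i f (x y : single B i f) : i != 0 -> x = y.
Proof. by move=> i0; move: x y; rewrite /= (negPf i0); exact: zero_bimod_eq. Qed.

Lemma single_val_inj : injective single_val.
Proof.
elim/quotW=> u; elim/quotW=> v.
rewrite (single_val_pi u) (single_val_pi v) => uv.
congr (\pi_(homK _ _) _); apply: chmap_eq => i f.
have [->|i0] := eqVneq i 0; first by move=> x; rewrite uv.
by move=> x; exact: single_eq.
Qed.

Definition single_map_val (b : bimhom B B) (i : int) :
    bimhom (single B i) (single B i) :=
  match i == 0 as z return
    bimhom (if z then B else zero_bimod A) (if z then B else zero_bimod A) with
  | true => b
  | false => 0
  end.

Fact single_map_cd (b : bimhom B B) (i j : int) (e : j = i + 1) f (x : single B i f) :
  bfun (single_map_val b j) (bfun (cd (single B) e) x)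
  = bfun (cd (single B) e) (bfun (single_map_val b i) x).
Proof. by rewrite /= linear0. Qed.

Lemma single_val_surj (b : bimhom B B) : exists f, single_val f = b.
Proof.
pose u := @Chmap _ _ _ (single B) (single B) (single_map_val b) (single_map_cd b).
by exists (\pi_(homK _ _) u); rewrite single_val_pi.
Qed.
End EndSingle.
End TotalHomK.

(** * The center *)

Section CenterEnd.
Variables (k : comPzRingType) (C : gradingCategory k) (A : galgebra C).
Implicit Types u v : bimhom (regular A) (regular A).

Definition unit_val u (X : C) : A (idm X) := bfun u (one A X).

Lemma bfun_unitl u (X Y : C) (g : hom X Y) (e : g = g ∘ idm X) (a : A g) :
  bfun u (a : regular A g) = uval (alpha (idm X) (idm X) g) *: mu e (unit_val u X) a.
Proof.
have := bfun_ract u e (one A X) a; rewrite [ract _ _ _]mu_1l => ua.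
rewrite -[mu _ _ _]ua linearZ /=.
by rewrite scalerA uvalV scale1r.
Qed.

Lemma bfun_unitr u (X Y : C) (g : hom X Y) (e : g = idm Y ∘ g) (a : A g) :
  mu e a (unit_val u Y) = uval (alpha g (idm Y) (idm Y)) *: bfun u (a : regular A g).
Proof.
have := bfun_lact u e a (one A Y); rewrite [lact _ _ _]mu_1r => ua.
by rewrite -[LHS]ua linearZ.
Qed.

(** The value u(a) is computed both from 1·a and from a·1; comparing the results leaves the product
    of the two unit constants, which is ζ(g). *)
Lemma unit_val_center u : in_center (unit_val u).
Proof.
move=> X Y g el er a; rewrite bfun_unitr (bfun_unitl u er) scalerA.
by rewrite [_ * uval (alpha g _ _)]mulrC.
Qed.

Lemma unit_val_comp u v : unit_val (bimcomp u v) = zmul (unit_val u) (unit_val v).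
Proof.
apply: functional_extensionality_dep => X.
rewrite /zmul [LHS](bfun_unitl u (esym (comp_idl (idm X)))).
by rewrite alpha_id2 scale1r.
Qed.

Lemma unit_val_id : unit_val (bimid (regular A)) = one A.
Proof. by []. Qed.

Lemma unit_val_inj : injective unit_val.
Proof.
move=> u v uv; apply: bimhom_eq => -[X Y g] a.
by rewrite !(bfun_unitl _ (esym (comp_idr g))) uv.
Qed.

Section Surj.
Variable z : forall X : C, A (idm X).
Hypothesis zC : in_center z.

(** The scalar is the one that [bfun_unitl] forces on an endomorphism sending each 1_X to [z X]. *)
Definition center_mul (f : mor C) : regular A f -> regular A f :=
  let: Mor X Y g := f in fun a =>
    uval (alpha (idm X) (idm X) g) *: mu (esym (comp_idr g)) (z X) a.

(** By centrality the same map is a right multiplication. This form yields compatibility with the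
    left action, the defining form that with the right action. *)
Lemma center_mulE (X Y : C) (g : hom X Y) (e : g = idm Y ∘ g) (a : A g) :
  center_mul (f := g) a = uinv (alpha g (idm Y) (idm Y)) *: mu e a (z Y).
Proof.
rewrite (zC e (esym (comp_idr g))) scalerA [uval _ * _]mulrC.
by rewrite kunitK.
Qed.

Fact center_mul_linear f : linear (center_mul (f := f)).
Proof.
case: f => X Y g c a b /=.
have -> := (mu_bilinear A (esym (comp_idr g))).2 (z X) c a b.
by rewrite scalerDr !scalerA mulrC.
Qed.

Fact center_mul_lact (X Y Z : C) (f : hom X Y) (g : hom Y Z)
    (h : hom X Z) (e : h = g ∘ f) (a : A f) (m : A g) :
  center_mul (f := h) (mu e a m) = mu e a (center_mul (f := g) m).
Proof.
have eh := esym (comp_idl h); have eg := esym (comp_idl g).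
rewrite (center_mulE eh) (center_mulE eg) muZr (mu_assoc e eh eg e) scalerA.
congr (_ *: _).
have := alpha_comp_id f g; rewrite -e => E.
apply: (kunitI (u := alpha h (idm Z) (idm Z))); rewrite kunitVK E.
by rewrite -mulrA uvalV mulr1.
Qed.

Fact center_mul_ract (X Y Z : C) (f : hom X Y) (g : hom Y Z)
    (h : hom X Z) (e : h = g ∘ f) (m : A f) (a : A g) :
  center_mul (f := h) (mu e m a) = mu e (center_mul (f := f) m) a.
Proof.
rewrite /= muZl (mu_assoc _ e e (esym (comp_idr h))) scalerA.
by rewrite -alpha_id_comp -e.
Qed.

Definition center_hom : bimhom (regular A) (regular A) :=
  @BimHom _ _ _ (regular A) (regular A) center_mul
    center_mul_linear center_mul_lact center_mul_ract.

Lemma unit_val_surj : exists u, unit_val u = z.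
Proof.
exists center_hom; apply: functional_extensionality_dep => X.
rewrite -[LHS]/(uval _ *: mu _ (z X) (one A X)) alpha_id2 scale1r.
by rewrite mu_1r alpha_id2 scale1r.
Qed.
End Surj.
End CenterEnd.

Lemma inj_surj_bijective (S T : Type) (f : S -> T) :
  injective f -> (forall y, exists x, f x = y) -> bijective f.
Proof.
move=> fI fS; exists (fun y => projT1 (cid (fS y))) => [x|y]; last by case: cid.
by apply: fI; case: cid.
Qed.

(** * From End(M) to End(A) and from Aut(M) to the central units *)

Section EndInvertible.
Variables (k : comPzRingType) (C : gradingCategory k) (A : galgebra C).
Variables M N : complex A.
Local Notation I := (single (regular A)).
Variables (e : homK (tot N M) I) (e' : homK I (tot N M)).
Hypotheses (e'e : compK e' e = idK _) (ee' : compK e e' = idK _).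
Hypothesis MN : isoK (tot M N) I.

Definition end_val (f : homK M M) : bimhom (regular A) (regular A) :=
  single_val (compK (compK e (totr N f)) e').

Lemma end_val_linear : linear end_val.
Proof.
move=> c f g; rewrite /end_val totr_linear compK_linear_r compK_linear_l.
exact: single_val_linear.
Qed.

Lemma end_val_comp f g : end_val (compK f g) = bimcomp (end_val f) (end_val g).
Proof.
rewrite /end_val -single_val_comp totr_comp; congr single_val.
by rewrite -!compKA [compK e' _]compKA e'e comp1K.
Qed.

Lemma end_val_id : end_val (idK M) = bimid _.
Proof. by rewrite /end_val totr_id compK1 ee' single_val_id. Qed.

Lemma end_val_inj : injective end_val.
Proof.
move=> f g /single_val_inj fg; apply: (totr_inj MN).
have conjK (p : homK (tot N M) (tot N M)) : p = compK e' (compK (compK (compK e p) e') e).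
  by rewrite -!compKA e'e compK1 compKA e'e comp1K.
by rewrite (conjK (totr N f)) fg -conjK.
Qed.

Lemma end_val_surj b : exists f, end_val f = b.
Proof.
have [g <-] := single_val_surj b.
have NM : isoK (tot N M) I by exists e, e'.
have [f fE] := totr_surj MN NM (compK (compK e' g) e).
exists f; rewrite /end_val fE; congr single_val.
by rewrite -!compKA ee' compK1 compKA ee' comp1K.
Qed.

Lemma aut_val_proof (f : autK M) : `[< in_center (unit_val (end_val (val f))) /\
  exists z', in_center z' /\ zmul (unit_val (end_val (val f))) z' = one A >].
Proof.
apply/asboolP; split; first exact: unit_val_center.
have [g [_ fg]] := autK_inv_ex f.
exists (unit_val (end_val g)); split; first exact: unit_val_center.
by rewrite -unit_val_comp -end_val_comp fg end_val_id unit_val_id.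
Qed.

Definition aut_val (f : autK M) : Zstar A :=
  exist _ (unit_val (end_val (val f))) (aut_val_proof f).

Lemma aut_valM : {morph aut_val : f g / (f * g)%g}.
Proof. by move=> f g; apply: val_inj; rewrite /= end_val_comp unit_val_comp. Qed.

Lemma aut_val_inj : injective aut_val.
Proof.
move=> f g /(congr1 val) /unit_val_inj /end_val_inj fg.
exact: val_inj.
Qed.

(** Preimages of [z] and of its inverse are inverse to each other, because [end_val] and [unit_val]
    are injective and multiplicative. *)
Lemma aut_val_surj z : exists f, aut_val f = z.
Proof.
have [p [zC pC zp]] := Zstar_inv_ex z.
have [u uz] := unit_val_surj zC; have [v vp] := unit_val_surj pC.
have [f fu] := end_val_surj u; have [g gv] := end_val_surj v.
have fg : compK f g = idK M.
  apply: end_val_inj; apply: unit_val_inj.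
  by rewrite end_val_comp unit_val_comp fu gv uz vp zp end_val_id.
(* [Zstar] supplies the inverse on the right of [z]; centrality moves it to the left. *)
have gf : compK g f = idK M.
  apply: end_val_inj; apply: unit_val_inj.
  by rewrite end_val_comp unit_val_comp fu gv uz vp zmulC // zp end_val_id.
have fP : `[< exists v, compK v f = idK M /\ compK f v = idK M >].
  by apply/asboolP; exists g.
exists (exist _ f fP); apply: val_inj.
by rewrite /= fu uz.
Qed.
End EndInvertible.

Theorem proposition4p3 (k : comPzRingType) (C : gradingCategory k)
    (A : galgebra C) (M : complex A) (hM : invertible M) :
  (exists phi : {linear homK M M -> bimhom (regular A) (regular A)},
     bijective phi) /\
  (exists psi : {multiplicative autK M -> Zstar A}, bijective psi).
Proof.
have [N [[e [e' [e'e ee']]] MN]] := hM.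
pose phi : {linear homK M M -> bimhom (regular A) (regular A)} :=
  HB.pack (end_val e e') (GRing.isLinear.Build k _ _ *:%R _ (end_val_linear e e')).
pose psi : {multiplicative autK M -> Zstar A} :=
  HB.pack (aut_val e'e ee') (isMultiplicative.Build _ _ _ (aut_valM e'e ee')).
split; [exists phi | exists psi]; apply: inj_surj_bijective.
- exact: end_val_inj e'e MN.
- exact: end_val_surj e'e ee' MN.
- exact: aut_val_inj MN.
- exact: aut_val_surj MN.
Qed.
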